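(* Let $\Omega\subset\mathbb C^d$ be a bounded domain such that $(\Omega,K_\Omega)$ is a complete metric space. If $\Omega$ is visible then there exists a frame of geodesics for $\Omega$.
   Context: $K_\Omega$ is the Kobayashi distance of $\Omega$; $|\cdot|$ and $\mathrm{dist}$ refer to the Euclidean norm and distance, and $\partial\Omega$ is the Euclidean boundary. Geodesics: a geodesic is a curve $\gamma:I\to\Omega$ ($I\subset\mathbb R$ an interval) with $K_\Omega(\gamma(s),\gamma(t))=|s-t|$ for all $s,t\in I$; it is a geodesic segment if $I$ is compact and a geodesic ray if $I=[a,+\infty)$. Visible: $\Omega$ is visible if for all $p,q\in\partial\Omega$ with $p\neq q$ there exist neighborhoods $V_p$ of $p$ and $V_q$ of $q$ with $V_p\cap V_q=\emptyset$ and a compact set $K\subset\Omega$ such that every geodesic segment joining a point $x\in V_p\cap\Omega$ to a point $y\in V_q\cap\Omega$ intersects $K$. Uniform convergence: let $\gamma_k$ be curves defined on $[0,R_k]$, $R_k\in(0,+\infty]$. The sequence $\{\gamma_k\}$ converges uniformly to a curve $\gamma$ defined on $[0,a]$, $a\in(0,+\infty]$, if $a=\lim_{k\to\infty}R_k$ and for every $\theta>0$ there is $k_0$ such that for every $k\ge k_0$ and every $t\in[0,R_k]$ one has $|\gamma_k(t)-\gamma(t)|\le\theta$ (in particular $\gamma(t)$ must be defined for these $t$). Here a ray that has a limit at $+\infty$ is regarded as defined on $[0,+\infty]$ with value at $+\infty$ equal to that limit (a point of $\partial\Omega$). Frame of geodesics (a frame of quasi-geodesics all of whose elements are geodesics):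 a family $\mathcal F$ of curves such that (1) for every $\gamma\in\mathcal F$ there is $R_\gamma\in(0,+\infty]$ such that, if $R_\gamma<+\infty$, $\gamma:[0,R_\gamma]\to\Omega$ is a geodesic segment, and if $R_\gamma=+\infty$, $\gamma:[0,+\infty)\to\Omega$ is a geodesic ray; (2) if $\gamma\in\mathcal F$ is a ray ($R_\gamma=+\infty$) there is $p_\gamma\in\partial\Omega$ with $\lim_{t\to+\infty}\gamma(t)=p_\gamma$; (3) there is a compact set $K\subset\Omega$ with $\gamma(0)\in K$ for every $\gamma\in\mathcal F$; (4) every sequence $\{\gamma_k\}\subset\mathcal F$ has a subsequence $\{\gamma_{k_m}\}$ converging uniformly to some $\gamma\in\mathcal F$, that is, $R_\gamma=\lim_{m\to\infty}R_{\gamma_{k_m}}$ and for every $\theta>0$ there is $m_0$ such that for every $m\ge m_0$ and every $t\in[0,R_{\gamma_{k_m}}]$ the value $\gamma(t)$ is defined and $|\gamma_{k_m}(t)-\gamma(t)|\le\theta$ (rays in $\mathcal F$ being regarded as defined on $[0,+\infty]$, with value at $+\infty$ equal to their limit); (5) there are $\epsilon>0$ and $\delta>0$ such that for every $z\in\Omega$ with $\mathrm{dist}(z,\partial\Omega)<\epsilon$ there are $\gamma\in\mathcal F$ and a point $w\in\Omega$ in the image of $\gamma$ with $K_\Omega(z,w)<\delta$. *)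

(* Defs.v *)
From HB Require Import structures.
From mathcomp Require Import all_boot all_order all_algebra.
From mathcomp Require Import all_classical all_reals all_analysis.
From mathcomp Require Import complex.

Set Implicit Arguments.
Unset Strict Implicit.
Unset Printing Implicit Defensive.

Import Order.TTheory GRing.Theory Num.Theory.
Import numFieldNormedType.Exports.

Local Open Scope classical_set_scope.
Local Open Scope ring_scope.

(* [^o] gives R[i] its topology and its normed module structure over itself,
   so that [derivable f z 1] is complex differentiability. The library norm on
   row vectors is the max norm; it induces the usual topology and the usual
   bounded sets, and [enorm] is used wherever the Euclidean norm itself
   matters. *)
Notation Cplx R := (R[i]^o).
Notation Cn R d := 'rV[R[i]^o]_d.

Definition enorm (R : realType) (d : nat) (z : Cn R d) : R :=
  Num.sqrt (\sum_(j < d) Normc.normc (z 0 j) ^+ 2).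

Definition boundary (T : topologicalType) (A : set T) : set T :=
  closure A `\` A°.

(* The infimum is over a nonempty set as soon as A is nonempty. *)
Definition edist (R : realType) (d : nat) (z : Cn R d) (A : set (Cn R d)) : R :=
  inf [set enorm (z - p) | p in A].

Definition is_domain (T : topologicalType) (A : set T) : Prop :=
  [/\ A !=set0, open A & connected A].

Definition unit_disc (R : realType) : set (Cplx R) :=
  [set z | Normc.normc z < 1].

Definition poincare_dist (R : realType) (a b : Cplx R) : R :=
  let rho := Normc.normc ((a - b) / (1 - conjc a * b)) in
  2^-1 * ln ((1 + rho) / (1 - rho)).

(* f is a total function, but only its values on the disc matter. *)
Definition holomorphic_disc (R : realType) (d : nat) (Omega : set (Cn R d))
    (f : Cplx R -> Cn R d) : Prop :=
  (forall z, unit_disc z -> derivable f z 1) /\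
  (forall z, unit_disc z -> Omega (f z)).

(* s is the length of a chain of the n + 1 holomorphic discs f 0, ..., f n
   going from z to w. *)
Definition kobayashi_chain (R : realType) (d : nat) (Omega : set (Cn R d))
    (z w : Cn R d) (s : R) : Prop :=
  exists (n : nat) (f : nat -> Cplx R -> Cn R d) (a b : nat -> Cplx R),
    [/\ forall i, (i <= n)%N ->
          [/\ holomorphic_disc Omega (f i), unit_disc (a i) & unit_disc (b i)],
        f 0%N (a 0%N) = z,
        f n (b n) = w,
        forall i, (i < n)%N -> f i (b i) = f i.+1 (a i.+1) &
        s = \sum_(0 <= i < n.+1) poincare_dist (a i) (b i)].

(* Chains exist between any two points of a domain, so that the infimum is
   then over a nonempty set of nonnegative reals. *)
Definition kobayashi (R : realType) (d : nat) (Omega : set (Cn R d))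
    (z w : Cn R d) : R :=
  inf [set s | kobayashi_chain Omega z w s].

Definition metric_on (R : realType) (T : Type) (A : set T) (D : T -> T -> R) :
    Prop :=
  [/\ forall x y, A x -> A y -> 0 <= D x y,
      forall x y, A x -> A y -> (D x y = 0 <-> x = y),
      forall x y, A x -> A y -> D x y = D y x &
      forall x y z, A x -> A y -> A z -> D x z <= D x y + D y z].

Definition complete_metric_on (R : realType) (T : Type) (A : set T)
    (D : T -> T -> R) : Prop :=
  metric_on A D /\
  forall u : nat -> T, (forall k, A (u k)) ->
    (forall e, 0 < e -> exists N, forall m n, (N <= m)%N -> (N <= n)%N ->
      D (u m) (u n) < e) ->
    exists2 x, A x & D (u k) x @[k --> \oo] --> 0.

Definition is_geodesic (R : realType) (d : nat) (Omega : set (Cn R d))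
    (I : set R) (g : R -> Cn R d) : Prop :=
  [/\ {within I, continuous g},
      g @` I `<=` Omega &
      forall s t, I s -> I t -> kobayashi Omega (g s) (g t) = `|s - t|].

Definition visible (R : realType) (d : nat) (Omega : set (Cn R d)) : Prop :=
  forall p q, boundary Omega p -> boundary Omega q -> p != q ->
  exists Vp Vq K : set (Cn R d),
    [/\ nbhs p Vp, nbhs q Vq & Vp `&` Vq = set0] /\
    [/\ compact K, K `<=` Omega &
        forall (a b : R) (g : R -> Cn R d), a <= b ->
          is_geodesic Omega `[a, b] g ->
          (Vp `&` Omega) (g a) -> (Vq `&` Omega) (g b) ->
          g @` `[a, b] `&` K !=set0].

(* A curve defined on [0, R_g] with R_g = clen g, or on [0, +oo[ when
   clen g = +oo. Values of cmap outside cdom are irrelevant. *)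
Record curve (R : realType) (d : nat) := Curve {
  clen : \bar R;
  cmap : R -> Cn R d
}.

Definition cdom (R : realType) (d : nat) (g : curve R d) : set R :=
  [set t | 0 <= t /\ (t%:E <= clen g)%E].

(* Rays extended to +oo by their limit. *)
Definition cval (R : realType) (d : nat) (g : curve R d) (t : \bar R) : Cn R d :=
  match t with
  | r%:E => cmap g r
  | _ => lim (cmap g r @[r --> +oo])
  end.

(* t <= clen g says that g is defined at t. *)
Definition curve_cvg (R : realType) (d : nat) (u : nat -> curve R d)
    (g : curve R d) : Prop :=
  clen (u k) @[k --> \oo] --> clen g /\
  forall theta : R, 0 < theta -> exists k0, forall k, (k0 <= k)%N ->
    forall t : \bar R, (0 <= t)%E -> (t <= clen (u k))%E ->
      (t <= clen g)%E /\ enorm (cval (u k) t - cval g t) <= theta.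

Definition frame_of_geodesics (R : realType) (d : nat) (Omega : set (Cn R d))
    (F : set (curve R d)) : Prop :=
  [/\ forall g, F g -> (0 < clen g)%E /\ is_geodesic Omega (cdom g) (cmap g),
      forall g, F g -> clen g = +oo%E ->
        exists2 p, boundary Omega p & cmap g t @[t --> +oo] --> p,
      exists K : set (Cn R d),
        [/\ compact K, K `<=` Omega & forall g, F g -> K (cmap g 0)],
      forall u : nat -> curve R d, (forall k, F (u k)) ->
        exists phi : nat -> nat, {homo phi : m n / (m < n)%N} /\
        exists2 g, F g & curve_cvg (u \o phi) g &
      exists eps delta : R, [/\ 0 < eps, 0 < delta &
        forall z, Omega z -> edist z (boundary Omega) < eps ->
          exists2 g, F g & exists w,
            [/\ Omega w, (cmap g @` cdom g) w & kobayashi Omega z w < delta]]].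

(* Main.v *)
(* The frame consists of all geodesics issued from a fixed point x0 whose length
   is a positive multiple of a fixed c > 0 or +oo. Every point of Omega is then
   within c of the frame, because a geodesic from x0 to z can be cut at the last
   multiple of c. In a sequence of such geodesics the lengths are constant or
   tend to +oo along a subsequence. In the first case Arzela-Ascoli gives a
   uniform limit. In the second it gives a limit ray, locally uniformly; if the
   convergence were not uniform up to the ends, far tails of the geodesics would
   join neighbourhoods of two distinct boundary points, and visibility would
   force them back into a fixed compact set.

   Existence of geodesics is the Hopf-Rinow theorem for the length metric K. That
   K induces the Euclidean topology needs no Schwarz lemma: affine discs bound K
   from above, and conversely a sequence of short chains leaving a small sphere
   around z would cross it at points accumulating at a point at distance 0 from
   z, contradicting that K is a metric. *)
Require Import Defs.
From mathcomp Require Import all_boot all_order all_algebra.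
From mathcomp Require Import all_classical all_reals all_analysis.
From mathcomp Require Import complex ring lra.
Import numFieldNormedType.Exports.
Set Implicit Arguments.
Unset Strict Implicit.
Unset Printing Implicit Defensive.
Import Order.TTheory GRing.Theory Num.Theory.
Local Open Scope classical_set_scope.
Local Open Scope ring_scope.

(** * Real-valued max norm on [Cn R d] and compactness of bounded sets *)

Section RealNorm.
Variables (R : realType) (d : nat).
Implicit Types (x y z p q : Cn R d) (V : set (Cn R d)).

(** The norm on [Cn R d] takes values in [R[i]]; its real part makes estimates over the ordered
    field [R] possible. *)
Definition rnorm z : R := complex.Re `|z|.

Lemma rnormE z : `|z| = (rnorm z)%:C%C.
Proof. by rewrite /rnorm RRe_real// ger0_real. Qed.

Lemma rnorm_ge0 z : 0 <= rnorm z.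
Proof. by rewrite -ler0c -rnormE. Qed.

Lemma rnormD x y : rnorm (x + y) <= rnorm x + rnorm y.
Proof. by rewrite -lecR rmorphD/= -!rnormE ler_normD. Qed.

Lemma rdistC x y : rnorm (x - y) = rnorm (y - x).
Proof. by rewrite /rnorm distrC. Qed.

Lemma rdist_triangle z x y : rnorm (x - y) <= rnorm (x - z) + rnorm (z - y).
Proof. by rewrite (le_trans _ (rnormD _ _))// addrA subrK. Qed.

Lemma rnorm0 : rnorm 0 = 0.
Proof. by rewrite /rnorm normr0. Qed.

Lemma rnorm_eq0 z : rnorm z = 0 -> z = 0.
Proof. by move=> z0; apply/eqP; rewrite -normr_eq0 rnormE z0. Qed.

Lemma rnormZ (a : Cplx R) z : rnorm (a *: z) = Normc.normc a * rnorm z.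
Proof. by apply: complexI; rewrite -rnormE normrZ rnormE rmorphM. Qed.

Lemma nbhs_rnormP p V :
  nbhs p V <-> exists2 r : R, 0 < r & forall q, rnorm (p - q) < r -> V q.
Proof.
split=> [/(@nbhs_normP _ (Cn R d) p V)[e /= e0 eV]|[r r0 rV]].
  have er : e = (complex.Re e)%:C%C by rewrite RRe_real// gtr0_real.
  exists (complex.Re e); first by rewrite -ltcR -er.
  by move=> q pq; apply: eV; rewrite /ball_/= rnormE er ltcR.
apply/(@nbhs_normP _ (Cn R d) p V); exists (r%:C)%C; first by rewrite /= ltcR.
by move=> q; rewrite /ball_/= rnormE ltcR; exact: rV.
Qed.

Lemma normc_coord z j : Normc.normc (z 0 j) <= rnorm z.
Proof.
rewrite -lecR -rnormE.
have -> : `|z| = mx_norm z by reflexivity.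
have -> : (Normc.normc (z 0 j))%:C%C = `|z 0 j| by reflexivity.
rewrite mx_normE; change `|z 0 j| with (`|z 0 j|%:nng%:num).
rewrite num_le.
exact: (le_bigmax _ (fun i : 'I_1 * 'I_d => `|z i.1 i.2|%:nng) (0, j)).
Qed.

Lemma rnorm_continuous (T : topologicalType) (f : T -> Cn R d) z :
  continuous f -> continuous (fun t => rnorm (z - f t)).
Proof.
move=> cf t; apply/cvgrPdist_lt => e e0.
have : nbhs (f t) [set q | rnorm (f t - q) < e] by apply/nbhs_rnormP; exists e.
move=> /(cf t) /= near_ft; near=> u.
have fe : rnorm (f t - f u) < e by near: u; exact: near_ft.
apply: le_lt_trans _ fe.
have := rdist_triangle (f t) z (f u); have := rdist_triangle (f u) z (f t).
by rewrite (rdistC (f u)) ler_norml => ? ?; apply/andP; split; lra.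
Unshelve. all: by end_near. Qed.

(** The disc lies in the image of a compact square under the continuous map [(a, b) |-> a + ib]. *)
Lemma complex_disc_compact (M : R) :
  exists2 C : set (Cplx R), compact C & forall w, Normc.normc w <= M -> C w.
Proof.
pose f (ab : R * R) : Cplx R := (ab.1 +i* ab.2)%C.
exists (f @` (`[-M, M] `*` `[-M, M])).
  apply: continuous_compact.
    apply: continuous_subspaceT => -[a b].
    apply/(@cvgrPdist_lt _ (Cplx R)) => e e0.
    have er : e = (complex.Re e)%:C%C by rewrite RRe_real// gtr0_real.
    have r0 : 0 < complex.Re e by rewrite -ltcR -er.
    near=> x.
    have h1 : `|a - x.1| < complex.Re e / 2.
      near: x; apply: (@cvgr_dist_lt _ _ _ _ _ fst a); last by rewrite divr_gt0.
      exact: cvg_fst.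
    have h2 : `|b - x.2| < complex.Re e / 2.
      near: x; apply: (@cvgr_dist_lt _ _ _ _ _ snd b); last by rewrite divr_gt0.
      exact: cvg_snd.
    rewrite er.
    have -> : f (a, b) - f x = (a - x.1)%:C%C + (0 +i* (b - x.2))%C :> Cplx R.
      by rewrite /f/=; simpc.
    rewrite (_ : `|_| = (Normc.normc ((a - x.1)%:C%C + (0 +i* (b - x.2))%C))%:C%C)//.
    rewrite ltcR (le_lt_trans (le_normcD _ _))//=.
    rewrite expr0n/= addr0 add0r !sqrtr_sqr; lra.
  by apply: compact_setX; exact: segment_compact.
move=> [a b] /= ab; exists (a, b) => //=; rewrite !in_itv/= -!ler_norml.
split; apply: le_trans ab; rewrite -sqrtr_sqr ler_wsqrtr//.
  by rewrite lerDl sqr_ge0.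
by rewrite lerDr sqr_ge0.
Unshelve. all: by end_near. Qed.

Lemma rball_compact (M : R) :
  exists2 C : set (Cn R d), compact C & forall z, rnorm z <= M -> C z.
Proof.
have [C cC MC] := complex_disc_compact M.
exists [set v : Cn R d | forall i, C (v ord0 i)].
  exact: (@rV_compact (Cplx R) d (fun=> C)).
by move=> z zM i; apply: MC; exact: le_trans (normc_coord z i) zM.
Qed.

Lemma enorm_small (e : R) : 0 < e ->
  exists2 r : R, 0 < r & forall z, rnorm z <= r -> enorm z <= e.
Proof.
move=> e0; exists (e / (d.+1%:R)); first by rewrite divr_gt0.
(* The factor [d.+1] is a crude substitute for the square root of [d]: it is never zero and its
   square dominates [d]. *)
move=> z zr; rewrite /enorm -(ger0_norm (ltW e0)) -sqrtr_sqr ler_wsqrtr//.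
have h j : Normc.normc (z 0 j) ^+ 2 <= (e / d.+1%:R) ^+ 2.
  rewrite lerXn2r// ?nnegrE ?divr_ge0 ?(ltW e0)//.
    by rewrite -ler0c; exact: (normr_ge0 (z 0 j)).
  exact: le_trans (normc_coord _ _) zr.
apply: (le_trans (ler_sum _ (fun j _ => h j))).
rewrite sumr_const card_ord expr_div_n -[leLHS]mulr_natr -mulrA ler_piMr ?sqr_ge0//.
rewrite mulrC ler_pdivrMr ?exprn_gt0// mul1r expr2 -natrM ler_nat.
by rewrite mulSn ltnW// ltnS leq_addr.
Qed.

End RealNorm.

(** * Cluster points and extraction of subsequences *)

Section Cluster.
Variables (R : realType) (d : nat).

(** By Tychonoff, maps into a fixed compact set form a compact space for pointwise convergence.
    Neighbourhoods there control finitely many points at a time, which is all that the later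
    equicontinuity argument uses. *)
Lemma family_cluster (T : eqType) (h : nat -> T -> Cn R d) (M : R) :
  (forall k t, rnorm (h k t) <= M) ->
  exists g : T -> Cn R d, forall (ts : seq T) (r : R), 0 < r -> forall N,
    exists2 k, (N <= k)%N & forall t, t \in ts -> rnorm (g t - h k t) < r.
Proof.
move=> hM; have [C cC MC] := rball_compact d M.
have cA : @compact (prod_topology (fun _ : T => Cn R d))
    [set f | forall t, C (f t)].
  by apply: (@tychonoff T (fun _ => Cn R d) (fun _ => C)).
have [] := cA ((h : nat -> prod_topology (fun _ : T => Cn R d)) @ \oo) (fmap_proper_filter _ _).
  by exists 0%N => // k _ t; exact/MC/hM.
move=> g [_ clg]; exists g => ts r r0 N.
have hN : (h @ \oo) [set f | exists2 k, (N <= k)%N & f = h k].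
  by exists N => // k Nk; exists k.
pose PT := prod_topology (fun _ : T => Cn R d).
have Fg : Filter (nbhs (g : PT)) by exact: nbhs_filter.
have gV : nbhs (g : PT) [set f | forall t, t \in ts -> rnorm (g t - f t) < r].
  elim: ts => [|t ts IH].
    by apply: (@filterS _ _ Fg setT) => [f _ t|]; [rewrite in_nil|exact: filterT].
  have gt : nbhs (g : PT) [set f | rnorm (g t - f t) < r].
    have := @proj_continuous T (fun _ : T => Cn R d) t g
      [set q | rnorm (g t - q) < r].
    by apply; apply/nbhs_rnormP; exists r.
  apply: (@filterS _ _ Fg _ _ _ (@filterI _ _ Fg _ _ gt IH)) => f [fgt fgts] t'.
  by rewrite inE => /predU1P[->//|]; exact: fgts.
by have [_ [[k Nk ->] ?]] := clg _ _ hN gV; exists k.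
Qed.

Definition seq_cluster (u : nat -> Cn R d) (q : Cn R d) :=
  forall r : R, 0 < r -> forall N, exists2 k, (N <= k)%N & rnorm (q - u k) < r.

Lemma bounded_cluster (u : nat -> Cn R d) (M : R) :
  (forall k, rnorm (u k) <= M) -> exists q, seq_cluster u q.
Proof.
move=> uM; have [g gP] := @family_cluster unit (fun k _ => u k) M (fun k _ => uM k).
exists (g tt) => r r0 N; have [k Nk kP] := gP [:: tt] r r0 N.
by exists k => //; apply: kP; rewrite inE.
Qed.

End Cluster.

Lemma extract_subseq (P : nat -> nat -> Prop) :
  (forall j N, exists2 k, (N <= k)%N & P j k) ->
  exists phi : nat -> nat,
    {homo phi : m n / (m < n)%N} /\ forall j, P j (phi j).
Proof.
move=> /(fun h => choice (fun jN : nat * nat =>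
  let: ex_intro2 k a b := h jN.1 jN.2 in ex_intro _ k (conj a b)))[F FP].
pose phi := fix phi j := if j is j'.+1 then F (j, (phi j').+1) else F (0, 0)%N.
exists phi; split; last first.
  by case=> [|j]; [have [] := FP (0, 0)%N|have [] := FP (j.+1, (phi j).+1)].
apply: homo_ltn; first exact: ltn_trans.
by move=> j; have [] := FP (j.+1, (phi j).+1).
Qed.

Lemma subseq_ge (phi : nat -> nat) : {homo phi : m n / (m < n)%N} ->
  forall n, (n <= phi n)%N.
Proof.
by move=> phiS; elim=> // n IH; exact: leq_ltn_trans IH (phiS _ _ (ltnSn n)).
Qed.

(** * The Poincaré distance of the disc and its geodesics *)

Section Poincare.
Variable R : realType.
Local Notation N := (@Normc.normc R).
Implicit Types (a b u z w : Cplx R).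

Lemma normcRE (x : R) : N x%:C%C = `|x|.
Proof. by rewrite /= expr0n/= addr0 sqrtr_sqr. Qed.

Lemma normc_ge0 z : 0 <= N z.
Proof. by case: z => x y; exact: sqrtr_ge0. Qed.

Lemma sqr_normcE z : (N z ^+ 2)%:C%C = z * conjc z :> R[i].
Proof. by rewrite -sqr_normc rmorphXn. Qed.

Lemma normcJE z : N (conjc z) = N z.
Proof. by apply: complexI; exact: normcJ. Qed.

(** Source of both the bound below 1 on the pseudo-hyperbolic distance and the non-vanishing of its
    denominator. *)
Lemma pseudo_dist_identity a b :
  N (1 - conjc a * b) ^+ 2 - N (a - b) ^+ 2 = (1 - N a ^+ 2) * (1 - N b ^+ 2).
Proof.
apply: complexI.
rewrite rmorphB [RHS]rmorphM !rmorphB !rmorph1 /= !sqr_normcE.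
rewrite !rmorphB rmorphM rmorph1 /= conjcK; ring.
Qed.

Lemma pseudo_dist_lt1 a b : N a < 1 -> N b < 1 ->
  N (a - b) < N (1 - conjc a * b).
Proof.
move=> a1 b1; rewrite -ltr_sqr ?nnegrE ?normc_ge0// -subr_gt0 pseudo_dist_identity.
by rewrite mulr_gt0// subr_gt0 expr_lt1 ?normc_ge0.
Qed.

Lemma denom_neq0 a b : N a < 1 -> N b < 1 -> 1 - conjc a * b != 0.
Proof.
move=> a1 b1; apply/eqP => h; have := pseudo_dist_lt1 a1 b1.
by rewrite h Normc.normc0 ltNge normc_ge0.
Qed.

Lemma normc_div z w : N (z / w) = N z / N w.
Proof. by rewrite Normc.normcM Normc.normcV. Qed.

Lemma pseudo_dist_bounds a b : N a < 1 -> N b < 1 ->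
  0 <= N ((a - b) / (1 - conjc a * b)) < 1.
Proof.
move=> a1 b1; rewrite normc_ge0/= normc_div ltr_pdivrMr ?mul1r.
  exact: pseudo_dist_lt1.
by rewrite (le_lt_trans _ (pseudo_dist_lt1 a1 b1)) ?normc_ge0.
Qed.

Lemma poincare_ge0 a b : N a < 1 -> N b < 1 -> 0 <= poincare_dist a b.
Proof.
move=> a1 b1; have /andP[r0 r1] := pseudo_dist_bounds a1 b1.
rewrite /poincare_dist mulr_ge0// ln_ge0// ler_pdivlMr; lra.
Qed.

(* The inverse of z |-> (z - a) / (1 - conjc a * z). *)
Definition mobius a z : Cplx R := (z + a) / (1 + conjc a * z).

Lemma mobius_denom a z : N a < 1 -> N z < 1 -> 1 + conjc a * z != 0.
Proof.
by move=> a1 z1; have := @denom_neq0 a (- z) a1; rewrite normcN mulrN opprK; exact.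
Qed.

Lemma mobius_disc a z : N a < 1 -> N z < 1 -> N (mobius a z) < 1.
Proof.
move=> a1 z1; have := @pseudo_dist_lt1 a (- z) a1.
rewrite normcN mulrN !opprK => /(_ z1) h.
rewrite /mobius addrC normc_div ltr_pdivrMr ?mul1r//.
exact: le_lt_trans (normc_ge0 _) h.
Qed.

(** The quotient is multiplied by [(1 + a * conjc z) / (1 + conjc a * z)], which has modulus 1
    because numerator and denominator are conjugate. *)
Lemma pseudo_dist_mobius a z w : N a < 1 -> N z < 1 -> N w < 1 ->
  N ((mobius a z - mobius a w) / (1 - conjc (mobius a z) * mobius a w)) =
  N ((z - w) / (1 - conjc z * w)).
Proof.
move=> a1 z1 w1.
have az := mobius_denom a1 z1; have aw := mobius_denom a1 w1.
have zw := denom_neq0 z1 w1.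
have aa : 1 - conjc a * a != 0 by exact: denom_neq0.
have caz : 1 + a * conjc z != 0.
  by rewrite -conjc_eq0 rmorphD rmorphM rmorph1 /= conjcK.
have -> : (mobius a z - mobius a w) / (1 - conjc (mobius a z) * mobius a w) =
    ((z - w) / (1 - conjc z * w)) * ((1 + a * conjc z) / (1 + conjc a * z)).
  rewrite /mobius rmorphM fmorphV !rmorphD rmorphM rmorph1 /= conjcK.
  have e : 1 - (conjc z + conjc a) / (1 + a * conjc z) *
      ((w + a) / (1 + conjc a * w)) =
      (1 - conjc z * w) * (1 - conjc a * a) /
      ((1 + a * conjc z) * (1 + conjc a * w)) :> R[i].
    by field; rewrite caz aw.
  rewrite e; field; rewrite az aw zw caz aa /=; done.
rewrite Normc.normcM (normc_div (1 + a * conjc z)).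
have -> : 1 + a * conjc z = conjc (1 + conjc a * z) :> R[i].
  by rewrite rmorphD rmorphM rmorph1 /= conjcK.
rewrite normcJE divff ?mulr1//; apply/eqP => /Normc.eq0_normc.
exact/eqP.
Qed.

(** The hyperbolic tangent, inverse to [x |-> 2^-1 * ln ((1 + x) / (1 - x))]. *)
Definition tanhR (s : R) : R := (expR (2 * s) - 1) / (expR (2 * s) + 1).

Lemma tanhR_denom s : 0 < expR (2 * s) + 1 :> R.
Proof. by rewrite addr_gt0 ?expR_gt0. Qed.

Lemma tanhR_lt1 s : `|tanhR s| < 1.
Proof.
have h := tanhR_denom s; have e := expR_gt0 (2 * s).
rewrite ltr_norml /tanhR ltr_pdivlMr// ltr_pdivrMr//; apply/andP; split; lra.
Qed.

Lemma tanhR_continuous : continuous tanhR.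
Proof.
move=> s; rewrite /tanhR.
have ce : expR (2 * t) @[t --> s] --> expR (2 * s).
  apply: continuous_cvg; first exact: continuous_expR.
  by apply: cvgM; [exact: cvg_cst|exact: cvg_id].
apply: cvgM; first by apply: cvgB => //; exact: cvg_cst.
apply: cvgV; first by rewrite gt_eqF ?tanhR_denom.
by apply: cvgD => //; exact: cvg_cst.
Qed.

Lemma real_complex_continuous : continuous (fun x : R => x%:C%C : Cplx R).
Proof.
move=> x; apply/(@cvgrPdist_lt _ (Cplx R)) => e e0.
have er : e = (complex.Re e)%:C%C by rewrite RRe_real// gtr0_real.
have r0 : 0 < complex.Re e by rewrite -ltcR -er.
near=> y; rewrite -rmorphB er.
rewrite (_ : `|_| = (N (x - y)%:C%C)%:C%C)// normcRE ltcR.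
by near: y; apply: cvgr_dist_lt.
Unshelve. all: by end_near. Qed.

(** The subtraction formula for the hyperbolic tangent: a diameter parametrized by [tanhR] has unit
    speed. *)
Lemma poincare_real_line u (s t : R) : N u = 1 ->
  poincare_dist ((tanhR s)%:C%C * u) ((tanhR t)%:C%C * u) = `|s - t|.
Proof.
move=> u1; rewrite /poincare_dist /=.
rewrite -mulrBl -rmorphB normc_div Normc.normcM u1 mulr1 normcRE.
have -> : conjc ((tanhR s)%:C%C * u) * ((tanhR t)%:C%C * u) =
    (tanhR s * tanhR t)%:C%C :> R[i].
  have -> : conjc ((tanhR s)%:C%C * u) = (tanhR s)%:C%C * conjc u :> R[i].
    by rewrite rmorphM; congr (_ * _); exact: conjc_real.
  rewrite mulrACA (mulrC (conjc u)) -sqr_normcE.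
  by rewrite u1 expr1n rmorph1 mulr1 -rmorphM.
rewrite -[1 : R[i]](rmorph1 (real_complex R)) -rmorphB normcRE.
wlog st : s t / t <= s.
  move=> H; have [/H//|/ltW/H] := leP t s.
  by rewrite (distrC t s) (distrC (tanhR t)) (mulrC (tanhR t)).
have es := expR_gt0 (2 * s); have et := expR_gt0 (2 * t).
have ds := tanhR_denom s; have dt := tanhR_denom t.
set x := expR (2 * s) in es ds *; set y := expR (2 * t) in et dt *.
have xy : y <= x by rewrite ler_expR ler_pM2l.
have e1 : tanhR s - tanhR t = 2 * (x - y) / ((x + 1) * (y + 1)).
  by rewrite /tanhR -/x -/y; field; rewrite !gt_eqF.
have e2 : 1 - tanhR s * tanhR t = 2 * (x + y) / ((x + 1) * (y + 1)).
  by rewrite /tanhR -/x -/y; field; rewrite !gt_eqF.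
rewrite e1 e2 !ger0_norm ?divr_ge0 ?mulr_ge0 ?subr_ge0 ?(ltW ds, ltW dt)//;
  last by rewrite addr_ge0// ltW.
set q := (X in (1 + X) / (1 - X)).
have -> : q = (x - y) / (x + y).
  by rewrite /q; field; rewrite !gt_eqF ?addr_gt0.
have -> : (1 + (x - y) / (x + y)) / (1 - (x - y) / (x + y)) = expR (2 * (s - t)).
  rewrite mulrBr expRD expRN -/x -/y; field.
  have -> : x + y - (x - y) = 2 * y by ring.
  by rewrite !gt_eqF ?addr_gt0 ?mulr_gt0.
by rewrite expRK mulrA mulVf ?mul1r.
Qed.

(** A Möbius isometry carries [0] to [a] and [- beta] to [b], so the image of the diameter through
    [- beta] is the required curve. *)
Lemma disc_geodesic a b : N a < 1 -> N b < 1 ->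
  exists c : R -> Cplx R,
    [/\ continuous c, forall s, N (c s) < 1, c 0 = a,
        c (poincare_dist a b) = b &
        forall s t, poincare_dist (c s) (c t) = `|s - t|].
Proof.
move=> a1 b1; have /andP[r0 r1] := pseudo_dist_bounds a1 b1.
set beta := (a - b) / (1 - conjc a * b) in r0 r1.
(* If [beta] is zero then [a] and [b] coincide and any unit direction will do. *)
pose u : Cplx R := if N beta == 0 then 1 else - beta / (N beta)%:C%C.
have u1 : N u = 1.
  rewrite /u; case: ifPn => [_|bn0]; first exact: Normc.normc1.
  by rewrite normc_div normcN normcRE ger0_norm// divff.
have ub : (N beta)%:C%C * u = - beta.
  rewrite /u; case: ifPn => [/eqP h|bn0].
    by rewrite (Normc.eq0_normc h) Normc.normc0 mul0r oppr0.
  by rewrite mulrC divfK// (inj_eq (@complexI R)).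
have xu1 s : N ((tanhR s)%:C%C * u) < 1.
  by rewrite Normc.normcM u1 mulr1 normcRE tanhR_lt1.
exists (fun s => mobius a ((tanhR s)%:C%C * u)); split.
- move=> s.
  have c1 : ((tanhR t)%:C%C : Cplx R) @[t --> s] --> ((tanhR s)%:C%C : Cplx R).
    exact: (continuous_comp (@tanhR_continuous s) (@real_complex_continuous _)).
  have c2 : ((tanhR t)%:C%C * u : Cplx R) @[t --> s] -->
      ((tanhR s)%:C%C * u : Cplx R).
    exact: (@cvgM R[i] _ _ _ _ _ _ _ c1 (cvg_cst _)).
  have c3 : ((tanhR t)%:C%C * u + a : Cplx R) @[t --> s] -->
      ((tanhR s)%:C%C * u + a : Cplx R).
    exact: (cvgD c2 (cvg_cst _)).
  have c4 : (1 + conjc a * ((tanhR t)%:C%C * u) : Cplx R) @[t --> s] -->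
      (1 + conjc a * ((tanhR s)%:C%C * u) : Cplx R).
    exact: (cvgD (cvg_cst _) (@cvgM R[i] _ _ _ _ _ _ _ (cvg_cst _) c2)).
  exact: (@cvgM R[i] _ _ _ _ _ _ _ c3
    (@cvgV R[i] _ _ _ _ _ (mobius_denom a1 (xu1 s)) c4)).
- by move=> s; exact: mobius_disc.
- by rewrite /tanhR mulr0 expR0 subrr mul0r mul0r /mobius mulr0 addr0 add0r divr1.
- have -> : tanhR (poincare_dist a b) = N beta.
    rewrite /tanhR /poincare_dist mulrA divff// mul1r -/beta lnK; last first.
      by rewrite posrE divr_gt0; lra.
    by field; apply/andP; split; lra.
  rewrite ub /mobius /beta.
  have ab := denom_neq0 a1 b1; have aa := denom_neq0 a1 a1.
  field; rewrite ab /=.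
  have <- : 1 - conjc a * a = 1 - conjc a * b + conjc a * - (a - b) by ring.
  exact: aa.
- move=> s t; rewrite -(@poincare_real_line u s t)// /poincare_dist.
  by rewrite pseudo_dist_mobius.
Qed.

End Poincare.

(** * The Kobayashi distance as a length metric inducing the Euclidean topology *)

Section Kobayashi.
Variables (R : realType) (d : nat) (Omega : set (Cn R d)).
Local Notation K := (kobayashi Omega).

Lemma chain_ge0 z w s : kobayashi_chain Omega z w s -> 0 <= s.
Proof.
move=> [n [f [a [b [fab _ _ _ ->]]]]]; rewrite big_nat sumr_ge0// => i.
by move=> /andP[_ iN]; have [_ ai bi] := fab i iN; exact: poincare_ge0.
Qed.

Lemma kobayashi_le_chain z w s : kobayashi_chain Omega z w s -> K z w <= s.
Proof. by apply: ge_inf; exists 0 => ?; exact: chain_ge0. Qed.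

Lemma chain_disc f a b : holomorphic_disc Omega f -> unit_disc a ->
  unit_disc b -> kobayashi_chain Omega (f a) (f b) (poincare_dist a b).
Proof.
move=> hf a1 b1; exists 0%N, (fun=> f), (fun=> a), (fun=> b).
by split=> //; rewrite big_nat1.
Qed.

Lemma affine_derivable (z v : Cn R d) (t : Cplx R) :
  derivable (fun s : Cplx R => z + s *: v) t 1.
Proof.
apply/derivable1_diffP; apply: differentiableD; first exact: differentiable_cst.
by have [] := is_diff_scalel t v.
Qed.

Lemma kobayashi_xx z : Omega z -> kobayashi_chain Omega z z 0.
Proof.
move=> Oz; have u0 : unit_disc (0 : Cplx R) by rewrite /unit_disc /mkset Normc.normc0 ltr01.
have hf : holomorphic_disc Omega (fun _ : Cplx R => z).
  by split => // t _; exact: derivable_cst.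
have := chain_disc hf u0 u0.
by rewrite /poincare_dist subrr mul0r Normc.normc0 addr0 subr0 divr1 ln1 mulr0.
Qed.

(** Composes the disc with a Poincaré geodesic; a single disc is already a chain, so the result is
    1-Lipschitz for [K]. *)
Lemma disc_path f a b : holomorphic_disc Omega f -> unit_disc a ->
  unit_disc b -> exists sigma : R -> Cn R d,
  [/\ continuous sigma, forall s, Omega (sigma s), sigma 0 = f a,
      sigma (poincare_dist a b) = f b &
      forall s t, K (sigma s) (sigma t) <= `|s - t|].
Proof.
move=> hf a1 b1; have [c [cc c1 c0 cl cst]] := disc_geodesic a1 b1.
exists (f \o c); split=> /=; rewrite ?c0 ?cl//.
- move=> s; apply: continuous_comp; first exact: cc.
  apply: differentiable_continuous; apply/derivable1_diffP.
  by apply hf.1; exact: c1.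
- by move=> s; apply: hf.2; exact: c1.
- by move=> s t; rewrite -cst; apply: kobayashi_le_chain; exact: chain_disc hf (c1 s) (c1 t).
Qed.

Hypothesis mK : metric_on Omega K.

Lemma kobayashi_ge0 x y : Omega x -> Omega y -> 0 <= K x y.
Proof. by case: mK => h _ _ _; exact: h. Qed.

Lemma kobayashi_eq0 x y : Omega x -> Omega y -> K x y = 0 -> x = y.
Proof. by case: mK => _ h _ _ Ox Oy; apply h. Qed.

Lemma kobayashi_refl x : Omega x -> K x x = 0.
Proof. by case: mK => _ h _ _ Ox; apply h. Qed.

Lemma kobayashiC x y : Omega x -> Omega y -> K x y = K y x.
Proof. by case: mK => _ _ h _; exact: h. Qed.

Lemma kobayashi_triangle y x z : Omega x -> Omega y -> Omega z ->
  K x z <= K x y + K y z.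
Proof. by case: mK => _ _ _ h Ox Oy Oz; exact: h. Qed.

(* No connectedness is needed: without chains the infimum would be the junk
   value 0, which separation of points rules out. *)
Lemma kobayashi_adherent x y e : Omega x -> Omega y -> 0 < e ->
  exists2 s, kobayashi_chain Omega x y s & s < K x y + e.
Proof.
move=> Ox Oy e0; apply: inf_adherent => //; split; last first.
  by exists 0 => ?; exact: chain_ge0.
apply/set0P/eqP => no_chain.
have xy : x = y by apply: kobayashi_eq0 => //; rewrite /kobayashi no_chain inf0.
suff : [set s | kobayashi_chain Omega x y s] 0 by rewrite no_chain.
by rewrite /= -xy; exact: kobayashi_xx.
Qed.

(** Continuity is required on all of [R], so that paths can be clamped and the intermediate value
    theorem applies. *)
Definition short_path (x y : Cn R d) (l : R) (sigma : R -> Cn R d) :=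
  [/\ continuous sigma, forall s, 0 <= s <= l -> Omega (sigma s), sigma 0 = x,
      sigma l = y &
      forall s t, 0 <= s -> s <= t -> t <= l -> K (sigma s) (sigma t) <= t - s].

Lemma short_path_cat x y z l1 l2 s1 s2 : 0 <= l1 -> 0 <= l2 ->
  short_path x y l1 s1 -> short_path y z l2 s2 ->
  exists sigma, short_path x z (l1 + l2) sigma.
Proof.
move=> l10 l20 [c1 O1 s10 s1l k1] [c2 O2 s20 s2l k2].
(* A sum of clamped paths is continuous without any gluing. *)
pose sigma s := s1 (Num.min s l1) + (s2 (Num.max s l1 - l1) - y).
have left s : s <= l1 -> sigma s = s1 s.
  by move=> sl; rewrite /sigma min_l// max_r// subrr s20 subrr addr0.
have right s : l1 <= s -> sigma s = s2 (s - l1).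
  by move=> sl; rewrite /sigma min_r// max_l// s1l addrC subrK.
exists sigma; split.
- move=> s; apply: cvgD.
    apply: (continuous_comp (f := fun s => Num.min s l1)); last exact: c1.
    by apply: continuous_min; [exact: cvg_id|exact: cvg_cst].
  apply: cvgB; last exact: cvg_cst.
  apply: (continuous_comp (f := fun s => Num.max s l1 - l1)); last exact: c2.
  apply: cvgB; last exact: cvg_cst.
  by apply: continuous_max; [exact: cvg_id|exact: cvg_cst].
- move=> s /andP[s0 sl]; have [h|h] := leP s l1.
    by rewrite left//; apply: O1; rewrite s0.
  by rewrite right ?ltW//; apply: O2; apply/andP; split; lra.
- by rewrite left.
- by rewrite right ?lerDl// addrAC subrr add0r.
- move=> s t s0 st tl; have [tl1|tl1] := leP t l1.
    by rewrite !left//; [exact: k1|exact: le_trans tl1].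
  have [sl1|sl1] := leP l1 s.
    rewrite !right//; last exact: ltW.
    have -> : t - s = (t - l1) - (s - l1) by lra.
    by apply: k2; lra.
  (* Here [s < l1 < t], and the estimate passes through the junction point [y]. *)
  rewrite left ?right; [|exact: ltW..].
  have Oy : Omega y by rewrite -s1l; apply: O1; lra.
  have h1 : K (s1 s) y <= l1 - s by rewrite -s1l; apply: k1; lra.
  have h2 : K y (s2 (t - l1)) <= (t - l1) - 0 by rewrite -s20; apply: k2; lra.
  apply: le_trans (kobayashi_triangle (y := y) _ _ _) _ => //.
  + by apply: O1; lra.
  + by apply: O2; lra.
  + lra.
Qed.

(** Each disc of the chain contributes a path as long as its Poincaré distance; these are
    concatenated. Hence [K] is a length metric. *)
Lemma chain_path x y l : kobayashi_chain Omega x y l ->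
  exists sigma, short_path x y l sigma.
Proof.
move=> [n [f [a [b [fab fx fy link ->]]]]].
have dpath i : (i <= n)%N -> exists sigma,
    short_path (f i (a i)) (f i (b i)) (poincare_dist (a i) (b i)) sigma.
  move=> /fab[hf ai bi]; have [c [cc Oc c0 cl ck]] := disc_path hf ai bi.
  exists c; split => // s t s0 st tl; rewrite (le_trans (ck _ _))//.
  by rewrite ler0_norm ?opprB// subr_le0.
elim: n y fy dpath fab link => [|n IH] y fy dpath fab link.
  by rewrite big_nat1 -fx -fy; exact: dpath.
have [i iN||i iN|s1 s1P] := IH (f n (b n)) erefl.
- by apply: dpath; exact: leqW.
- by move=> i iN; apply: fab; exact: leqW.
- by apply: link; exact: leqW.
rewrite big_nat_recr//=.
have [s2] := dpath n.+1 (leqnn _); rewrite -link// fy => s2P.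
apply: short_path_cat s1P s2P.
  rewrite big_nat sumr_ge0// => i /andP[_ iN].
  by have [|_ ai bi] := fab i; [exact: leqW|exact: poincare_ge0].
by have [_ ai bi] := fab n.+1 (leqnn _); exact: poincare_ge0.
Qed.

Hypothesis openO : open Omega.

(** The affine disc [t |-> z + t *: v] stays in a norm ball inside [Omega] and reaches [w] at the
    parameter [tanhR (e / 2)], at Poincaré distance [e / 2] from 0. *)
Lemma kobayashi_near z (e : R) : Omega z -> 0 < e ->
  exists2 r : R, 0 < r &
    forall w, rnorm (z - w) < r -> Omega w /\ K z w < e.
Proof.
move=> Oz e0.
have /nbhs_rnormP[r r0 rO] : nbhs z Omega by exact: open_nbhs_nbhs.
pose x := tanhR (e / 2).
have x0 : 0 < x.
  rewrite /x /tanhR divr_gt0 ?tanhR_denom// subr_gt0 expR_gt1; lra.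
exists (x * r) => [|w zw]; first exact: mulr_gt0.
pose v : Cn R d := (x^-1)%:C%C *: (w - z).
have rv : rnorm v < r.
  rewrite rnormZ normcRE gtr0_norm ?invr_gt0// rdistC mulrC ltr_pdivrMr//.
  by rewrite mulrC.
pose f (t : Cplx R) := z + t *: v.
have hf : holomorphic_disc Omega f.
  split=> [t _|t t1]; first exact: affine_derivable.
  apply: rO; rewrite /f opprD addrA subrr add0r.
  rewrite -sub0r rdistC subr0 rnormZ (le_lt_trans _ rv)//.
  by rewrite ler_piMl ?rnorm_ge0// ltW.
pose p (s : R) : Cplx R := (tanhR s)%:C%C * 1.
have p1 s : unit_disc (p s).
  by rewrite /unit_disc /mkset /p mulr1 normcRE tanhR_lt1.
have fz : f (p 0) = z.
  by rewrite /f /p /tanhR mulr0 expR0 subrr mul0r mul0r scale0r addr0.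
have fw : f (p (e / 2)) = w.
  rewrite /f /p mulr1 -/x /v scalerA -rmorphM mulfV ?gt_eqF// rmorph1.
  by rewrite scale1r addrC subrK.
split.
  by rewrite -fw; exact: hf.2.
rewrite -fz -fw (le_lt_trans (kobayashi_le_chain (chain_disc hf (p1 _) (p1 _))))//.
rewrite poincare_real_line ?Normc.normc1// sub0r normrN gtr0_norm; lra.
Qed.

(* A short chain leaving a small sphere around z would meet it, so compactness
   of the sphere and separation of points suffice: no Schwarz lemma is used. *)
Lemma rnorm_near z (r : R) : Omega z -> 0 < r ->
  exists2 e : R, 0 < e & forall w, Omega w -> K z w < e -> rnorm (z - w) < r.
Proof.
(* Shrinking [r] puts the closed ball inside [Omega], so that cluster points on its sphere remain in
   [Omega]. *)
move=> Oz; wlog rO : r / forall w, rnorm (z - w) <= r -> Omega w.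
  move=> H r0; have /nbhs_rnormP[r1 r10 r1O] : nbhs z Omega.
    exact: open_nbhs_nbhs.
  have [||e e0 eP] := H (Num.min r (r1 / 2)).
  - move=> w h; apply: r1O; apply: le_lt_trans h _.
    by rewrite gt_min; apply/orP; right; lra.
  - by rewrite lt_min r0/=; lra.
  exists e => // w Ow zw; apply: lt_le_trans (eP w Ow zw) _.
  by rewrite ge_min lexx.
move=> r0; apply: contrapT => noe.
have sph n : exists y, rnorm (z - y) = r /\ K z y < n.+1%:R^-1.
  apply: contrapT => noy; apply: noe; exists (n.+1%:R^-1) => // w Ow zw.
  rewrite ltNge; apply/negP => rzw; apply: noy.
  have [|s cs sK] := @kobayashi_adherent z w (n.+1%:R^-1 - K z w) Oz Ow.
    by rewrite subr_gt0.
  have [sg [csg Osg sg0 sgs ksg]] := chain_path cs.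
  have s0 := chain_ge0 cs.
  have [||t] := @IVT R (fun t => rnorm (z - sg t)) 0 s r s0.
  - by apply: continuous_subspaceT; exact: rnorm_continuous.
  - rewrite sg0 sgs subrr rnorm0 min_l ?rnorm_ge0// max_r ?rnorm_ge0//.
    by rewrite rzw ltW.
  rewrite in_itv/= => /andP[t0 ts] zt; exists (sg t); split => //.
  have := ksg 0 t (lexx _) t0 ts; rewrite sg0 subr0 => h.
  by apply: le_lt_trans h (le_lt_trans ts _); move: sK; rewrite addrC subrK.
have [y yP] := choice sph.
have [|q qc] := @bounded_cluster R d y (rnorm z + r).
  move=> n; have := rnormD z (- (z - y n)); rewrite opprB addrC subrK.
  by rewrite rdistC; have [-> _] := yP n.
have qr : rnorm (z - q) = r.
  apply/eqP; rewrite eq_le; apply/andP; split; apply/ler_addgt0Pr => e e0.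
    have [k _ kq] := qc e e0 0%N; have [yk _] := yP k.
    have := rdist_triangle (y k) z q; rewrite (rdistC (y k) q); lra.
  have [k _ kq] := qc e e0 0%N; have [yk _] := yP k.
  have := rdist_triangle q z (y k); lra.
have Oq : Omega q by apply: rO; rewrite qr.
(* The points [y k] accumulate at [q] while [K z (y k)] tends to 0, although [q] lies on the
   sphere. *)
suff Kzq : K z q = 0.
  by move: qr; rewrite (kobayashi_eq0 Oz Oq Kzq) subrr rnorm0; lra.
apply/eqP; rewrite eq_le kobayashi_ge0// andbT; apply/ler_addgt0Pr => e e0.
have [r1 r10 r1P] := @kobayashi_near q (e / 2) Oq (divr_gt0 e0 (ltr0n _ 2)).
have [N _ NP] := near_infty_natSinv_lt (PosNum (divr_gt0 e0 (ltr0n R 2))).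
have [k Nk kq] := qc _ r10 N; have [Oyk Kqy] := r1P _ kq.
have Kzy : K z (y k) < e / 2 by apply: lt_trans (yP k).2 _; exact: NP Nk.
have := kobayashi_triangle (y := y k) Oz Oyk Oq.
rewrite (kobayashiC Oyk Oq); lra.
Qed.

End Kobayashi.

(** * Hopf-Rinow: compactness of closed Kobayashi balls *)

Section HopfRinow.
Variables (R : realType) (d : nat) (Omega : set (Cn R d)).
Local Notation K := (kobayashi Omega).
Hypothesis mK : metric_on Omega K.
Hypothesis openO : open Omega.

Definition kball (x : Cn R d) (r : R) : set (Cn R d) :=
  [set y | Omega y /\ K x y <= r].

Definition seq_compact (A : set (Cn R d)) :=
  forall u : nat -> Cn R d, (forall n, A (u n)) ->
    exists2 q, A q & seq_cluster u q.

Lemma seq_cluster_near u q (e : R) N : Omega q -> seq_cluster u q -> 0 < e ->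
  exists2 k, (N <= k)%N & Omega (u k) /\ K q (u k) < e.
Proof.
move=> Oq uq e0; have [r r0 rP] := kobayashi_near openO Oq e0.
by have [k Nk kP] := uq r r0 N; exists k => //; exact: rP.
Qed.

Lemma kobayashi_le_cluster x u q (c : R) : Omega x -> Omega q ->
  seq_cluster u q -> (forall n, K x (u n) <= c) -> K x q <= c.
Proof.
move=> Ox Oq uq uc; apply/ler_addgt0Pr => e e0.
have [k _ [Ok Kk]] := seq_cluster_near 0%N Oq uq e0.
have := kobayashi_triangle mK Ox Ok Oq; have := uc k.
rewrite (kobayashiC mK Ok Oq); lra.
Qed.

Lemma seq_cluster_subseq (u : nat -> Cn R d) phi q : {homo phi : m n / (m < n)%N} ->
  seq_cluster (u \o phi) q -> seq_cluster u q.
Proof.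
move=> phiS uq r r0 N; have [k Nk kr] := uq r r0 N; exists (phi k) => //.
exact: leq_trans (subseq_ge phiS k).
Qed.

(** A subsequence converging to [q] has a cluster point in [A], which can only be [q]. *)
Lemma seq_compact_closed A (u : nat -> Cn R d) q : seq_compact A -> (forall n, A (u n)) ->
  seq_cluster u q -> A q.
Proof.
move=> cA Au uq.
have [|phi [phiS phiP]] :=
    @extract_subseq (fun j k => rnorm (q - u k) < j.+1%:R^-1).
  by move=> j N; exact: uq.
have [q' Aq' q'P] := cA (u \o phi) (fun n => Au (phi n)).
suff -> : q = q' by [].
apply/eqP; rewrite -subr_eq0; apply/eqP/rnorm_eq0/eqP.
rewrite eq_le rnorm_ge0 andbT; apply/ler_addgt0Pr => e e0.
have e20 : 0 < e / 2 by rewrite divr_gt0.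
have [N _ NP] := near_infty_natSinv_lt (PosNum e20).
have [k Nk kP] := q'P _ e20 N.
have h : rnorm (q - u (phi k)) < e / 2 by apply: lt_trans (phiP k) _; exact: NP Nk.
have := rdist_triangle (u (phi k)) q q'; rewrite (rdistC (u (phi k)) q').
move: kP; rewrite /comp; lra.
Qed.

Lemma kball_sub_compact x r (B : set (Cn R d)) : Omega x -> seq_compact B ->
  B `<=` Omega -> kball x r `<=` B -> seq_compact (kball x r).
Proof.
move=> Ox cB BO rB u ur; have [q Bq uq] := cB u (fun n => rB _ (ur n)).
exists q => //; split; first exact: BO.
by apply: kobayashi_le_cluster uq _ => // [|n]; [exact: BO|exact: (ur n).2].
Qed.

(** A small ball for [K] lies in a norm ball of radius [r0 / 2], whose cluster points are still
    within [r0] of [x], hence in [Omega]. *)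
Lemma kball_locally_compact x : Omega x ->
  exists2 r : R, 0 < r & seq_compact (kball x r).
Proof.
move=> Ox; have [r0 r00 r0P] := kobayashi_near openO Ox ltr01.
have [|e e0 eP] := rnorm_near mK openO Ox (r := r0 / 2); first by rewrite divr_gt0.
exists (e / 2) => [|u uP]; first by rewrite divr_gt0.
have ur n : rnorm (x - u n) < r0 / 2.
  by have [Ou Ku] := uP n; apply: eP => //; lra.
have [|q qc] := @bounded_cluster R d u (rnorm x + r0).
  move=> n; have := rnormD x (- (x - u n)); rewrite opprB addrC subrK.
  by rewrite rdistC; have := ur n; lra.
have Oq : Omega q.
  apply: (r0P q _).1; have [k _ kP] := qc _ (divr_gt0 r00 (ltr0n _ 2)) 0%N.
  have := rdist_triangle (u k) x q; rewrite (rdistC (u k) q); have := ur k; lra.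
exists q => //; split=> //.
by apply: kobayashi_le_cluster qc _ => // n; exact: (uP n).2.
Qed.

(** A path from [x] to [y] of length less than [s + 2 * t] is cut at parameter [s], or at its end
    [y] if it is shorter. *)
Lemma kball_interpolate x y (s t : R) : Omega x -> Omega y -> 0 <= s -> 0 < t ->
  K x y <= s + t -> exists2 v, kball x s v & K v y < 2 * t.
Proof.
move=> Ox Oy s0 t0 xy.
have [l cl lK] := kobayashi_adherent mK Ox Oy t0; have l0 := chain_ge0 cl.
have [sg [_ Osg sg0 sgl ksg]] := chain_path mK cl.
have [sl|ls] := leP s l.
  exists (sg s).
    split; first by apply: Osg; rewrite s0.
    by rewrite -sg0 (le_trans (ksg _ _ _ _ _)) ?subr0.
  by rewrite -sgl (le_lt_trans (ksg _ _ _ _ _))//; lra.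
exists y; last by rewrite (kobayashi_refl mK)//; lra.
split=> //; have := ksg 0 l (lexx _) l0 (lexx _); rewrite sg0 sgl; lra.
Qed.

(** A sequence in the larger ball is followed at distance less than [r / 4] by one in the smaller
    ball. Around a cluster point [q] of the latter, a subsequence of the former stays in the compact
    ball of radius [r / 2]. *)
Lemma kball_compact_step x (r s : R) : Omega x -> 0 < r -> 0 <= s -> s <= r ->
  (forall y, kball x (2 * r) y -> seq_compact (kball y (r / 2))) ->
  seq_compact (kball x s) -> seq_compact (kball x (s + r / 8)).
Proof.
move=> Ox r0 s0 sr small cs u uP.
have r80 : 0 < r / 8 by rewrite divr_gt0.
have /choice[v vP] : forall n, exists v, kball x s v /\ K v (u n) < r / 4.
  move=> n; have [Ou Ku] := uP n.
  have [w ws wu] := kball_interpolate Ox Ou s0 r80 Ku.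
  by exists w; split => //; lra.
have [q [Oq Kq] vq] := cs v (fun n => (vP n).1).
have [|phi [phiS phiP]] := @extract_subseq (fun j k => K q (v k) < r / 4).
  move=> j N; have [|k Nk [_ kP]] := seq_cluster_near (e := r / 4) N Oq vq.
    by rewrite divr_gt0.
  by exists k.
have qu n : kball q (r / 2) ((u \o phi) n).
  have [Ou _] := uP (phi n); split=> //=.
  have [[Ov _] Kv] := vP (phi n).
  have := kobayashi_triangle mK Oq Ov Ou; have := phiP n; lra.
have [q' [Oq' _] uq'] : exists2 q', kball q (r / 2) q' & seq_cluster (u \o phi) q'.
  by apply: small qu; split=> //; lra.
exists q'; last exact: seq_cluster_subseq uq'.
split=> //; apply: (kobayashi_le_cluster Ox Oq' (seq_cluster_subseq phiS uq')).
by move=> n; exact: (uP n).2.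
Qed.

(** If all these half-size balls were compact, eight steps of size [r / 8] would carry compactness
    from radius 0 to radius [r]. *)
Lemma kball_noncompact_half x (r : R) : Omega x -> 0 < r ->
  ~ seq_compact (kball x r) ->
  exists2 y, kball x (2 * r) y & ~ seq_compact (kball y (r / 2)).
Proof.
move=> Ox r0 nc; apply: contrapT => noy; apply: nc.
have small y : kball x (2 * r) y -> seq_compact (kball y (r / 2)).
  by move=> xy; apply: contrapT => nc; apply: noy; exists y.
suff H n : (n <= 8)%N -> seq_compact (kball x (n%:R * (r / 8))).
  by have := H 8 (leqnn _); rewrite mulrC divfK.
elim: n => [_|n IH n8].
  rewrite mul0r; apply: (kball_sub_compact Ox (small x _)) => [|y []//|y []].
    by split=> //; rewrite (kobayashi_refl mK)// mulr_ge0// ltW.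
  by move=> Oy Ky; split=> //; rewrite (le_trans Ky)// divr_ge0// ltW.
have -> : n.+1%:R * (r / 8) = n%:R * (r / 8) + r / 8.
  by rewrite -natr1 mulrDl mul1r.
have n8' : n%:R <= 8 :> R by rewrite ler_nat ltnW.
apply: kball_compact_step => //; last exact/IH/ltnW.
- by rewrite mulr_ge0 ?divr_ge0// ltW.
- rewrite mulrA ler_pdivrMr// mulrC ler_pM2l//.
Qed.

Lemma halves_lt (r e : R) : 0 < r -> 0 < e -> exists N, forall n, (N <= n)%N ->
  r / 2 ^+ n < e.
Proof.
move=> r0 e0; have [N _ NP] := near_infty_natSinv_lt (PosNum (divr_gt0 e0 r0)).
exists N => n Nn; rewrite -ltr_pdivlMl// mulrC.
apply: le_lt_trans (NP n Nn); rewrite lef_pV2 ?posrE ?exprn_gt0//.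
by rewrite -natrX ler_nat ltn_expl.
Qed.

Hypothesis completeO : forall u : nat -> Cn R d, (forall k, Omega (u k)) ->
  (forall e, 0 < e -> exists N, forall m n, (N <= m)%N -> (N <= n)%N ->
    K (u m) (u n) < e) ->
  exists2 x, Omega x & K (u k) x @[k --> \oo] --> (0 : R).

(* A non-compact ball of radius r contains, up to doubling, the centre of a
   non-compact ball of radius r / 2; iterating, the centres would converge to a
   point without compact neighbourhood. *)
Lemma kball_compact x (r : R) : Omega x -> seq_compact (kball x r).
Proof.
move=> Ox; wlog r0 : r / 0 < r.
  move=> H; have [/H//|r0] := ltP 0 r.
  apply: (kball_sub_compact Ox (H _ ltr01)) => [y []//|y [Oy Ky]].
  by split=> //; lra.
apply: contrapT => nc.
pose bad n y := Omega y /\ ~ seq_compact (kball y (r / 2 ^+ n)).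
have /choice[F FP] : forall p : nat * Cn R d, exists y, bad p.1 p.2 ->
    kball p.2 (2 * (r / 2 ^+ p.1)) y /\ bad p.1.+1 y.
  move=> [n y] /=; have [b|nb] := pselect (bad n y); last by exists y.
  have [|z [Oz Kz] nz] := kball_noncompact_half b.1 _ b.2.
    by rewrite divr_gt0// exprn_gt0.
  by exists z; split=> //; split=> //; rewrite exprSr invfM mulrA.
pose xs := fix xs n := if n is n'.+1 then F (n', xs n') else x.
have xs_bad n : bad n (xs n).
  by elim: n => [|n IH]; [rewrite /bad expr0 divr1|exact: (FP (n, xs n) IH).2].
have step n : K (xs n) (xs n.+1) <= 2 * (r / 2 ^+ n).
  exact: (FP (n, xs n) (xs_bad n)).1.2.
have Oxs n : Omega (xs n) := (xs_bad n).1.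
(* The bound [2 * (r / 2 ^+ n)] on each step is the difference of consecutive values of
   [4 * (r / 2 ^+ n)], so the sum telescopes. *)
have tail m k : K (xs m) (xs (m + k)%N) <= 4 * (r / 2 ^+ m) - 4 * (r / 2 ^+ (m + k)).
  elim: k => [|k IH]; first by rewrite addn0 subrr (kobayashi_refl mK).
  have := kobayashi_triangle mK (Oxs m) (Oxs (m + k)%N) (Oxs (m + k).+1).
  have := step (m + k)%N; rewrite addnS (exprSr _ (m + k)) invfM mulrA; lra.
have cauchy e : 0 < e -> exists N, forall m n, (N <= m)%N -> (N <= n)%N ->
    K (xs m) (xs n) < e.
  move=> e0; have [N NP] := halves_lt r0 (divr_gt0 e0 (ltr0n R 4)).
  exists N; suff H m n : (N <= m)%N -> (m <= n)%N -> K (xs m) (xs n) < e.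
    move=> m n Nm Nn; have [mn|nm] := leqP m n; first exact: H.
    by rewrite (kobayashiC mK)//; apply: H => //; exact: ltnW.
  move=> Nm mn; have := tail m (n - m)%N; rewrite subnKC//.
  have := NP m Nm; have : 0 <= r / 2 ^+ n by rewrite divr_ge0 ?exprn_ge0// ltW.
  lra.
have [y Oy /cvgrPdist_lt yP] := completeO Oxs cauchy.
have [rho rho0 crho] := kball_locally_compact Oy.
have rho20 : 0 < rho / 2 by rewrite divr_gt0.
have [N1 NP1] := halves_lt r0 rho20.
have [N2 _ NP2] := yP _ rho20.
pose n := maxn N1 N2.
have h1 := NP1 n (leq_maxl _ _).
have h2 : K (xs n) y < rho / 2.
  have := NP2 n (leq_maxr _ _); rewrite /= sub0r normrN.
  by rewrite ger0_norm ?(kobayashi_ge0 mK).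
(* The non-compact ball around [xs n] has become small enough to lie inside the compact ball around
   the limit [y]. *)
apply: (xs_bad n).2; apply: (kball_sub_compact (Oxs n) crho) => [z []//|z [Oz Kz]].
split=> //; have := kobayashi_triangle mK Oy (Oxs n) Oz.
rewrite (kobayashiC mK Oy (Oxs n)); lra.
Qed.

End HopfRinow.

(** * Limits of curves and existence of geodesics *)

Section Geodesics.
Variables (R : realType) (d : nat) (Omega : set (Cn R d)).
Local Notation K := (kobayashi Omega).
Hypothesis mK : metric_on Omega K.
Hypothesis openO : open Omega.
Hypothesis compactK : forall x (r : R), Omega x -> seq_compact (kball Omega x r).

(** Uniform version of [rnorm_near]: pairs violating it for ever smaller [e] would cluster at a
    point of [A] where [rnorm_near] fails. *)
Lemma kobayashi_unif A (r : R) : seq_compact A -> A `<=` Omega -> 0 < r ->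
  exists2 e : R, 0 < e &
    forall x y, A x -> Omega y -> K x y < e -> rnorm (x - y) < r.
Proof.
move=> cA AO r0; apply: contrapT => noe.
have r20 : 0 < r / 2 by rewrite divr_gt0.
have /choice[p pP] : forall n, exists p : Cn R d * Cn R d,
    [/\ A p.1, Omega p.2, K p.1 p.2 < n.+1%:R^-1 & r <= rnorm (p.1 - p.2)].
  move=> n; apply: contrapT => nop; apply: noe; exists (n.+1%:R^-1) => //.
  move=> x y Ax Oy xy; rewrite ltNge; apply/negP => h; apply: nop.
  by exists (x, y).
have [|q Aq qc] := cA (fun n => (p n).1); first by move=> n; have [] := pP n.
have Oq := AO _ Aq.
have [e e0 eP] := rnorm_near mK openO Oq r20.
have e20 : 0 < e / 2 by rewrite divr_gt0.
have [N _ NP] := near_infty_natSinv_lt (PosNum e20).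
have [k Nk [Ok Kk]] := seq_cluster_near openO N Oq qc e20.
have [_ Op Kp rp] := pP k.
have Kp2 : K (p k).1 (p k).2 < e / 2 by apply: lt_trans Kp _; exact: NP Nk.
have h1 : rnorm (q - (p k).1) < r / 2 by apply: eP => //; lra.
have h2 : rnorm (q - (p k).2) < r / 2.
  by apply: eP => //; have := kobayashi_triangle mK Oq Ok Op; lra.
by have := rdist_triangle q (p k).1 (p k).2; rewrite (rdistC (p k).1 q); lra.
Qed.

(** Cluster point for pointwise convergence: the index may depend on the finite set [ts], so no
    fixed subsequence is asserted to converge. *)
Definition family_cvg (h : nat -> R -> Cn R d) (g : R -> Cn R d) :=
  forall (ts : seq R) (r : R), 0 < r -> forall N,
    exists2 k, (N <= k)%N & forall t, t \in ts -> rnorm (g t - h k t) < r.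

Lemma family_cvg_cluster h g t : family_cvg h g ->
  seq_cluster (fun k => h k t) (g t).
Proof.
move=> hg r r0 N; have [k Nk kP] := hg [:: t] r r0 N.
by exists k => //; apply: kP; rewrite inE.
Qed.

(** Each distance condition involves two parameters only, so it passes to a pointwise cluster point.
    Compactness of the balls keeps the limit in [Omega]. *)
Lemma limit_curve (M : R) x0 (D : set R) (h : nat -> R -> Cn R d) :
  (forall z, Omega z -> rnorm z <= M) -> Omega x0 ->
  (forall k t, kball Omega x0 `|t| (h k t)) ->
  (forall s t, D s -> D t -> forall e, 0 < e -> exists N, forall k, (N <= k)%N ->
    `|K (h k s) (h k t) - `|s - t| | <= e) ->
  exists g, [/\ forall t, kball Omega x0 `|t| (g t),
    forall s t, D s -> D t -> K (g s) (g t) = `|s - t| & family_cvg h g].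
Proof.
move=> OM Ox0 hball hD.
have [|g hg] := @family_cluster R d R h M.
  by move=> k t; apply: OM; exact: (hball k t).1.
have gball t : kball Omega x0 `|t| (g t).
  apply: seq_compact_closed (family_cvg_cluster t hg); first exact: compactK.
  by move=> k; exact: hball.
exists g; split=> // s t Ds Dt; apply/eqP; rewrite -subr_eq0 -normr_le0.
apply/ler_addgt0Pr => e e0; rewrite add0r.
have e30 : 0 < e / 3 by rewrite divr_gt0.
have [N NP] := hD s t Ds Dt _ e30.
have [Ogs _] := gball s; have [Ogt _] := gball t.
have [r1 r10 r1P] := kobayashi_near openO Ogs e30.
have [r2 r20 r2P] := kobayashi_near openO Ogt e30.
have [|k Nk kP] := hg [:: s; t] (Num.min r1 r2) _ N; first by rewrite lt_min r10.
have [Os Ks] : Omega (h k s) /\ K (g s) (h k s) < e / 3.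
  by apply: r1P; apply: lt_le_trans (kP s _) _; rewrite ?inE ?eqxx// ge_min lexx.
have [Ot Kt] : Omega (h k t) /\ K (g t) (h k t) < e / 3.
  apply: r2P; apply: lt_le_trans (kP t _) _; rewrite ?inE ?eqxx ?orbT//.
  by rewrite ge_min lexx orbT.
have := NP k Nk; rewrite ler_norml => /andP[l1 l2].
have t1 := kobayashi_triangle mK Ogs Os Ogt.
have t2 := kobayashi_triangle mK Os Ot Ogt.
have t3 := kobayashi_triangle mK Os Ogs Ot.
have t4 := kobayashi_triangle mK Ogs Ogt Ot.
rewrite ler_norml; rewrite (kobayashiC mK Ot Ogt) in t2.
rewrite (kobayashiC mK Os Ogs) in t3; apply/andP; split; lra.
Qed.

(** Continuity comes for free, since points close for [K] are close in norm. *)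
Lemma isometry_geodesic (D : set R) (g : R -> Cn R d) :
  (forall t, D t -> Omega (g t)) ->
  (forall s t, D s -> D t -> K (g s) (g t) = `|s - t|) ->
  is_geodesic Omega D g.
Proof.
move=> gO gK; split=> //; last by move=> _ [t Dt <-]; exact: gO.
apply/subspace_continuousP => t Dt V /nbhs_rnormP[r r0 rV].
have [e e0 eP] := rnorm_near mK openO (gO t Dt) r0.
rewrite nbhs_simpl /=; near=> s.
have Ds : D s by near: s; exact: withinT.
apply: rV; apply: eP; [exact: gO|rewrite gK//].
near: s; apply: cvg_within.
exact: (@nbhsx_ballx R R t e e0).
Unshelve. all: by end_near. Qed.

Definition lipschitz_curve x0 (m : R) (g : R -> Cn R d) :=
  forall t, 0 <= t <= m -> kball Omega x0 m (g t) /\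
    forall s, 0 <= s <= m -> K (g s) (g t) <= `|s - t|.

(** The Arzela-Ascoli step: [kobayashi_unif] turns the common Lipschitz bound for [K] into
    equicontinuity in norm, so closeness on a finite grid of mesh [e / 2] suffices. *)
Lemma family_cvg_unif x0 (m : R) h g N0 : Omega x0 -> 0 <= m ->
  lipschitz_curve x0 m g ->
  (forall k, (N0 <= k)%N -> lipschitz_curve x0 m (h k)) ->
  family_cvg h g ->
  forall r, 0 < r -> forall N, exists2 k, (N <= k)%N &
    forall t, 0 <= t <= m -> rnorm (g t - h k t) < r.
Proof.
move=> Ox0 m0 gL hL hg r r0 N.
have r30 : 0 < r / 3 by rewrite divr_gt0.
have [|e e0 eP] := kobayashi_unif (@compactK x0 m Ox0) _ r30; first by move=> y [].
pose dl := e / 2; have dl0 : 0 < dl by rewrite divr_gt0.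
pose n := Num.truncn (m / dl).
have [k] := hg [seq i%:R * dl | i <- iota 0 n.+1] _ r30 (maxn N0 N).
rewrite geq_max => /andP[N0k Nk] kP; exists k => // t /andP[t0 tm].
(* [i%:R * dl] is the last grid point not after [t]. *)
pose i := Num.truncn (t / dl).
have /andP[it ti] : i%:R * dl <= t < i.+1%:R * dl.
  rewrite -ler_pdivlMr// -ltr_pdivrMr//; apply: truncn_itv.
  by rewrite divr_ge0// ltW.
pose s := i%:R * dl.
have s0 : 0 <= s by rewrite mulr_ge0// ltW.
have sm : 0 <= s <= m by rewrite s0 (le_trans it).
have tm' : 0 <= t <= m by rewrite t0.
have st : `|t - s| < e.
  rewrite ger0_norm ?subr_ge0//; move: ti; rewrite -natr1 mulrDl mul1r -/s /dl; lra.
have sn : s \in [seq i%:R * dl | i <- iota 0 n.+1].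
  apply/mapP; exists i => //; rewrite mem_iota/= add0n ltnS.
  by apply: le_truncn; rewrite ler_pM2r ?invr_gt0.
have h1 := kP s sn.
have [[Ogt Kgt] gLt] := gL t tm'; have [[Ogs Kgs] gLs] := gL s sm.
have [[Oht Kht] hLt] := hL k N0k t tm'; have [[Ohs Khs] hLs] := hL k N0k s sm.
have h2 : rnorm (g t - g s) < r / 3.
  by apply: eP => //; rewrite (le_lt_trans _ st)//; exact: gLs.
have h3 : rnorm (h k t - h k s) < r / 3.
  by apply: eP => //; rewrite (le_lt_trans _ st)//; exact: hLs.
have := rdist_triangle (g s) (g t) (h k t).
have := rdist_triangle (h k s) (g s) (h k t).
rewrite (rdistC (h k s) (h k t)); lra.
Qed.

(** The geodesic is a cluster point of paths whose lengths tend to [K x y]. *)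
Lemma geodesic_exists (M : R) x y :
  (forall z, Omega z -> rnorm z <= M) -> Omega x -> Omega y ->
  exists g : R -> Cn R d, [/\ g 0 = x, g (K x y) = y &
    is_geodesic Omega [set t | 0 <= t <= K x y] g].
Proof.
move=> OM Ox Oy; set L := K x y.
have L0 : 0 <= L by exact: kobayashi_ge0.
have /choice[ls lsP] : forall n, exists ls : R * (R -> Cn R d),
    [/\ 0 <= ls.1, ls.1 < L + n.+1%:R^-1 & short_path Omega x y ls.1 ls.2].
  move=> n.
  have [|l cl lL] := @kobayashi_adherent _ _ _ mK x y (n.+1%:R^-1) Ox Oy.
    by rewrite invr_gt0.
  have [sg sgP] := chain_path mK cl; exists (l, sg); split => //.
  exact: chain_ge0 cl.
have Lls n : L <= (ls n).1.
  have [l0 _ [_ _ s0 sl ks]] := lsP n.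
  by have := ks 0 _ (lexx _) l0 (lexx _); rewrite s0 sl subr0.
(* Clamping defines the curves on all of [R] within distance [|t|] of [x], and changes nothing on
   [[0, L]] since no path is shorter than [L]. *)
pose clamp n t : R := Num.max 0 (Num.min t (ls n).1).
have clampP n t : 0 <= clamp n t <= (ls n).1 /\ clamp n t <= `|t|.
  have [l0 _ _] := lsP n; rewrite /clamp le_max lexx/= !ge_max l0/= normr_ge0/=.
  by rewrite !ge_min lexx orbT ler_norm.
have clamp_id n t : 0 <= t <= L -> clamp n t = t.
  move=> /andP[t0 tL]; rewrite /clamp min_l ?max_r//.
  exact: le_trans tL (Lls n).
pose D : set R := [set t | 0 <= t <= L].
pose h n t := (ls n).2 (clamp n t).
have hO n t : Omega (h n t).
  by have [_ _ [_ Osg _ _ _]] := lsP n; apply: Osg; exact: (clampP n t).1.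
have [||g [gball gK hg]] := @limit_curve M x D h OM Ox.
- move=> n t; split=> //; have [_ _ [_ _ s0 _ ks]] := lsP n.
  have [/andP[c0 cl] ct] := clampP n t.
  by apply: le_trans ct; have := ks 0 _ (lexx _) c0 cl; rewrite s0 subr0.
- move=> s t Ds Dt e e0; have [N _ NP] := near_infty_natSinv_lt (PosNum e0).
  exists N => k /NP /= ke; rewrite /h !clamp_id//; move: Ds Dt.
  have [l0 lL [_ Osg sg0 sgl ks]] := lsP k.
  have Lk := Lls k.
  wlog st : s t / s <= t.
    move=> H Ds Dt; have [st|/ltW ts] := leP s t; first exact: H.
    rewrite (kobayashiC mK) ?(distrC s t); first exact: H.
      by have := hO k s; rewrite /h clamp_id.
    by have := hO k t; rewrite /h clamp_id.
  move=> /andP[s0 sL] /andP[t0 tL].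
  have tl : t <= (ls k).1 by exact: le_trans tL Lk.
  have sl : s <= (ls k).1 by exact: le_trans sL Lk.
  have Os : Omega ((ls k).2 s) by apply: Osg; rewrite s0.
  have Ot : Omega ((ls k).2 t) by apply: Osg; rewrite t0.
  have k1 := ks s t s0 st tl.
  have k2 : K x ((ls k).2 s) <= s - 0 by rewrite -sg0; exact: ks.
  have k3 : K ((ls k).2 t) y <= (ls k).1 - t by rewrite -sgl; exact: ks.
  (* Going from [x] to [y] through both points shows that the distance falls short of [t - s] by at
     most the excess of the path length over [L]. *)
  have k4 := kobayashi_triangle mK Ox Os Oy.
  have k5 := kobayashi_triangle mK Os Ot Oy.
  move: lL ke k4; rewrite -/L; set i := _^-1 => lL ke k4.
  rewrite (ler0_norm (x := s - t)) ?subr_le0// ler_norml.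
  by apply/andP; split; lra.
have D0 : D 0 by rewrite /D/= lexx.
have DL : D L by rewrite /D/= L0 lexx.
have [Og0 Kg0] := gball 0; have [OgL _] := gball L.
have g0 : g 0 = x.
  apply/esym; apply: (kobayashi_eq0 mK Ox Og0); apply/eqP.
  by rewrite normr0 in Kg0; rewrite eq_le Kg0 (kobayashi_ge0 mK).
exists g; split=> //.
  apply: (kobayashi_eq0 mK OgL Oy); apply/eqP.
  rewrite eq_le (kobayashi_ge0 mK)// andbT; apply/ler_addgt0Pr => e e0.
  have e20 : 0 < e / 2 by rewrite divr_gt0.
  have [N _ NP] := near_infty_natSinv_lt (PosNum e20).
  have [k Nk [Ok Kk]] :=
    seq_cluster_near openO N OgL (family_cvg_cluster L hg) e20.
  have [l0 lL [_ _ sg0 sgl ks]] := lsP k.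
  have k1 : K (h k L) y <= (ls k).1 - L.
    by rewrite /h clamp_id// -sgl; apply: ks => //; exact: Lls.
  have k2 : k.+1%:R^-1 < e / 2 :> R by exact: NP Nk.
  have := kobayashi_triangle mK OgL Ok Oy.
  by move: lL k2; set i := _^-1 => lL k2; lra.
by apply: isometry_geodesic => // t _; exact: (gball t).1.
Qed.

End Geodesics.

(** * The frame of geodesics and its compactness *)

Section Frame.
Variables (R : realType) (d : nat) (Omega : set (Cn R d)).
Local Notation K := (kobayashi Omega).
Hypothesis mK : metric_on Omega K.
Hypothesis openO : open Omega.
Hypothesis compactK : forall x (r : R), Omega x -> seq_compact (kball Omega x r).
Hypothesis visO : visible Omega.
Variable M : R.
Hypothesis boundO : forall z, Omega z -> rnorm z <= M.
Variables (x0 : Cn R d) (c : R).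
Hypothesis Ox0 : Omega x0.
Hypothesis c0 : 0 < c.

(* Quantized lengths: a convergent sequence of lengths is then eventually
   constant or tends to +oo, so no element of a uniformly convergent sequence
   is longer than the limit. *)
Definition quantized_geodesics : set (curve R d) :=
  [set g | [/\ cmap g 0 = x0, is_geodesic Omega (cdom g) (cmap g) &
    clen g = +oo%E \/ exists n : nat, clen g = (n.+1%:R * c)%:E]].
Local Notation F := quantized_geodesics.

Lemma frame_len_gt0 g : F g -> (0 < clen g)%E.
Proof. by case=> _ _ [->|[n ->]]; rewrite ?ltry// lte_fin mulr_gt0. Qed.

Lemma frame_dom0 g : F g -> cdom g 0.
Proof. by move=> /frame_len_gt0 /ltW h; split. Qed.

Lemma frame_Omega g t : F g -> cdom g t -> Omega (cmap g t).
Proof. by move=> [_ [_ h _] _] gt; apply: h; exists t. Qed.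

Lemma frame_dist g s t : F g -> cdom g s -> cdom g t ->
  K (cmap g s) (cmap g t) = `|s - t|.
Proof. by move=> [_ [_ _ h] _]; exact: h. Qed.

Lemma frame_dist0 g t : F g -> cdom g t -> K x0 (cmap g t) = t.
Proof.
move=> Fg gt; have [<- _ _] := Fg; rewrite (frame_dist Fg)//; last exact: frame_dom0.
by rewrite sub0r normrN ger0_norm//; have [] := gt.
Qed.

Lemma cdom_le (g : curve R d) (s t : R) : cdom g t -> 0 <= s -> s <= t -> cdom g s.
Proof. by move=> [_ tg] s0 st; split=> //; apply: le_trans tg; rewrite lee_fin. Qed.

(** A sequence in [C] going to infinity for [K] would cluster at a point near which [K x0] is
    bounded. *)
Lemma compact_dist_bounded C : compact C -> C `<=` Omega ->
  exists T : R, forall z, C z -> K x0 z <= T.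
Proof.
move=> cC CO; apply: contrapT => noT.
have /choice[y yP] : forall n : nat, exists y, C y /\ n%:R < K x0 y.
  move=> n; apply: contrapT => noy; apply: noT; exists n%:R => z Cz.
  by rewrite leNgt; apply/negP => h; apply: noy; exists z.
have [|q [Cq clq]] := cC (y @ \oo) (fmap_proper_filter _ _).
  by exists 0%N => // k _; exact: (yP k).1.
have qc : seq_cluster y q.
  move=> r r0 N; have yN : (y @ \oo) [set z | exists2 k, (N <= k)%N & z = y k].
    by exists N => // k Nk; exists k.
  have qr : nbhs q [set z | rnorm (q - z) < r] by apply/nbhs_rnormP; exists r.
  by have [_ [[k Nk ->] ?]] := clq _ _ yN qr; exists k.
have Oq := CO _ Cq.
have [k Nk [Oy Ky]] :=
  seq_cluster_near openO (Num.truncn (K x0 q + 1)).+1 Oq qc ltr01.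
have := kobayashi_triangle mK Ox0 Oq Oy; have [_ yk] := yP k.
have : K x0 q + 1 < k%:R.
  by apply: lt_le_trans (truncnS_gt _) _; rewrite ler_nat.
lra.
Qed.

Lemma escaping_boundary (u : nat -> Cn R d) q : (forall n, Omega (u n)) ->
  (forall n, n%:R <= K x0 (u n)) -> seq_cluster u q -> boundary Omega q.
Proof.
move=> Ou Ku qc; split.
  move=> V /nbhs_rnormP[r r0 rV]; have [k _ kP] := qc r r0 0%N.
  by exists (u k); split=> //; exact: rV.
move=> /interior_subset Oq.
have [k Nk [_ Kk]] :=
  seq_cluster_near openO (Num.truncn (K x0 q + 1)).+1 Oq qc ltr01.
have := kobayashi_triangle mK Ox0 Oq (Ou k); have := Ku k.
have : K x0 q + 1 < k%:R.
  by apply: lt_le_trans (truncnS_gt _) _; rewrite ler_nat.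
lra.
Qed.

(** The form in which visibility is used: a stretch of geodesic from near [p] to near [q] meets a
    compact set, all of whose points are within [T] of [x0], but after time [T] the geodesic is
    farther than that. *)
Lemma no_far_tails p q : boundary Omega p -> boundary Omega q -> p != q ->
  exists r T : R, 0 < r /\ forall g, F g -> forall s t, 0 <= s -> s <= t ->
    cdom g t -> T < s -> rnorm (p - cmap g s) < r ->
    rnorm (q - cmap g t) < r -> False.
Proof.
move=> bp bq pq.
have [Vp [Vq [C [[]]]]] := visO bp bq pq.
move=> /nbhs_rnormP[rp rp0 rpV] /nbhs_rnormP[rq rq0 rqV] _ [cC CO meet].
have [T TP] := compact_dist_bounded cC CO.
exists (Num.min rp rq), T; split; first by rewrite lt_min rp0.
move=> g Fg s t s0 st gt Ts ps qt.
have gs := cdom_le gt s0 st.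
have dom tau : s <= tau <= t -> cdom g tau.
  by move=> /andP[h1 h2]; apply: cdom_le gt _ h2; exact: le_trans h1.
have [|||_ [[tau taust <-] Ctau]] := meet s t (cmap g) st.
- apply: isometry_geodesic => // [a|a b]; rewrite /= !in_itv/=.
    by move=> /dom; exact: frame_Omega.
  by move=> /dom ga /dom gb; exact: frame_dist.
- split; last exact: frame_Omega.
  by apply: rpV; apply: lt_le_trans ps _; rewrite ge_min lexx.
- split; last exact: frame_Omega.
  by apply: rqV; apply: lt_le_trans qt _; rewrite ge_min lexx orbT.
move: taust; rewrite /= in_itv/= => taust.
have := TP _ Ctau; rewrite frame_dist0//; last exact: dom.
by case/andP: taust; lra.
Qed.

Lemma cvg_pinfty_rnormP (g : R -> Cn R d) (p : Cn R d) :
  g t @[t --> +oo] --> p <->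
  forall r : R, 0 < r -> exists T, forall t, T < t -> rnorm (p - g t) < r.
Proof.
split=> [gp r r0|gp V /nbhs_rnormP[r r0 rV]].
  have /gp[T [_ TP]] : nbhs p [set z | rnorm (p - z) < r].
    by apply/nbhs_rnormP; exists r.
  by exists T.
by have [T TP] := gp r r0; exists T; split; [exact: num_real|move=> t /TP; exact: rV].
Qed.

Lemma ray_dom (g : curve R d) t : clen g = +oo%E -> 0 <= t -> cdom g t.
Proof. by move=> gy t0; split=> //; rewrite gy leey. Qed.

(** Two distinct cluster points at infinity would both lie on the boundary, and the ray would have
    far tails joining their neighbourhoods. *)
Lemma ray_limit g : F g -> clen g = +oo%E ->
  exists2 p, boundary Omega p & cmap g t @[t --> +oo] --> p.
Proof.
move=> Fg gy.
have dom t : 0 <= t -> cdom g t by exact: ray_dom.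
have Og t : 0 <= t -> Omega (cmap g t) by move=> /dom; exact: frame_Omega.
have [|p pc] := @bounded_cluster R d (fun n => cmap g n%:R) M.
  by move=> n; apply: boundO; exact: Og.
have bp : boundary Omega p.
  apply: escaping_boundary pc => n; first exact: Og.
  by rewrite frame_dist0//; exact: dom.
exists p => //; apply/cvg_pinfty_rnormP => r r0; apply: contrapT => noT.
have /choice[t tP] : forall n : nat, exists t, n%:R < t /\ r <= rnorm (p - cmap g t).
  move=> n; apply: contrapT => not; apply: noT; exists n%:R => t nt.
  by rewrite ltNge; apply/negP => h; apply: not; exists t.
have t0 n : 0 <= t n by rewrite (le_trans _ (ltW (tP n).1)).
have [|q qc] := @bounded_cluster R d (fun n => cmap g (t n)) M.
  by move=> n; apply: boundO; exact: Og.
have bq : boundary Omega q.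
  apply: escaping_boundary qc => n; first exact: Og.
  by rewrite frame_dist0 ?(ltW (tP n).1)//; exact: dom.
have pq : p != q.
  apply/eqP => pq; have [k _] := qc r r0 0%N; have := (tP k).2.
  by rewrite -pq leNgt => /negP.
have [r' [T [r'0 far]]] := no_far_tails bp bq pq.
(* First a late time [k] near [p], then [l >= k], so that [t l > k] is a later time near [q]. *)
have [k Tk kP] := pc r' r'0 (Num.truncn T).+1.
have [l kl lP] := qc r' r'0 k.
apply: (far g Fg k%:R (t l)) => //; first 2 last.
- by apply: lt_le_trans (truncnS_gt _) _; rewrite ler_nat.
- by apply: le_trans (ltW (tP l).1); rewrite ler_nat.
- exact: dom.
Qed.

Lemma geodesic_in_frame y (n : nat) : Omega y -> n.+1%:R * c <= K x0 y ->
  exists g, [/\ F g, cdom g (n.+1%:R * c) &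
    K (cmap g (n.+1%:R * c)) y = K x0 y - n.+1%:R * c].
Proof.
move=> Oy ncy.
have [g [g0 gL [_ gO gK]]] := geodesic_exists mK openO compactK boundO Ox0 Oy.
have n0 : 0 <= n.+1%:R * c by rewrite mulr_ge0// ltW.
pose G := Curve (n.+1%:R * c)%:E g.
have Gdom t : cdom G t -> 0 <= t <= K x0 y.
  by rewrite /cdom/= lee_fin => -[-> h] /=; exact: le_trans h ncy.
have Gn : cdom G (n.+1%:R * c) by split=> //=; rewrite lexx.
exists G; split => //.
  split=> //=; last by right; exists n.
  apply: isometry_geodesic => // [t /Gdom h|s t /Gdom ? /Gdom ?].
    by apply: gO; exists t.
  exact: gK.
rewrite /= -[X in K _ X]gL gK/= ?lexx ?n0 ?kobayashi_ge0//.
by rewrite ler0_norm ?opprB// subr_le0.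
Qed.

Lemma frame_dense x1 z : Omega x1 -> K x0 x1 = c -> Omega z ->
  exists2 g, F g & exists w, [/\ Omega w, (cmap g @` cdom g) w & K z w < c].
Proof.
move=> Ox1 K1 Oz; have [zc|cz] := ltP (K x0 z) c.
  (* Close to [x0] the point [x0] itself serves; the geodesic towards [x1], at distance exactly [c],
     shows that the frame is nonempty. *)
  have [|g [Fg _ _]] := @geodesic_in_frame x1 0%N Ox1; first by rewrite mul1r K1.
  exists g => //; exists x0; split=> //; last by rewrite (kobayashiC mK).
  by exists 0; [exact: frame_dom0|case: Fg].
have cz1 : 1 <= K x0 z / c by rewrite ler_pdivlMr// mul1r.
have /andP[n1 n2] := truncn_itv (le_trans ler01 cz1).
case: (Num.truncn _) n1 n2 => [|n] n1 n2; first by lra.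
rewrite ler_pdivlMr// in n1; rewrite ltr_pdivrMr// in n2.
have [g [Fg gn Kg]] := geodesic_in_frame Oz n1.
exists g => //; exists (cmap g (n.+1%:R * c)); split.
- exact: frame_Omega.
- by exists (n.+1%:R * c).
- rewrite (kobayashiC mK)//; last exact: frame_Omega.
  by rewrite Kg ltrBlDl; move: n2; rewrite -[n.+2%:R]natr1 mulrDl mul1r.
Qed.

(** Locally uniform convergence in diagonal form: the index [k] governs the interval, the precision
    and the length at once. *)
Definition locally_close (g : R -> Cn R d) (w : nat -> curve R d) :=
  forall k, (k%:R%:E < clen (w k))%E /\
    forall t, 0 <= t <= k%:R -> rnorm (g t - cmap (w k) t) < k.+1%:R^-1.

(** Failure produces points on ever later parts of the [w k], clustering at a boundary point [q]
    other than the limit [p] of [g]. At a fixed large time the same curves are still near [p],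
    against [no_far_tails]. *)
Lemma uniform_tail (g : curve R d) (w : nat -> curve R d) : F g ->
  clen g = +oo%E -> (forall k, F (w k)) -> locally_close (cmap g) w ->
  forall r : R, 0 < r -> exists k0, forall k, (k0 <= k)%N -> forall t,
    cdom (w k) t -> rnorm (cmap (w k) t - cmap g t) < r.
Proof.
move=> Fg gy Fw gw r r0; apply: contrapT => nok.
have [N _ NP] := near_infty_natSinv_lt (PosNum r0).
(* The bad times exceed the index, because [locally_close] excludes them on [[0, k]]. *)
have /choice[f fP] : forall n : nat, exists f : nat * R,
    [/\ (n <= f.1)%N, cdom (w f.1) f.2, f.1%:R < f.2 &
      r <= rnorm (cmap (w f.1) f.2 - cmap g f.2)].
  move=> n; apply: contrapT => nof; apply: nok; exists (maxn n N) => k.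
  rewrite geq_max => /andP[nk Nk] t wt; rewrite ltNge; apply/negP => rt.
  apply: nof; exists (k, t); split=> //=; rewrite ltNge; apply/negP => tk.
  have [_ /(_ t)] := gw k; rewrite tk wt.1 rdistC => /(_ isT) h.
  by have := lt_trans h (NP k Nk); rewrite /= ltNge rt.
pose y n := cmap (w (f n).1) (f n).2.
have Oy n : Omega (y n) by have [_ h _ _] := fP n; exact: frame_Omega.
have nf n : n%:R < (f n).2.
  by have [h _ h' _] := fP n; apply: le_lt_trans h'; rewrite ler_nat.
have [q qc] := @bounded_cluster R d y M (fun n => boundO (Oy n)).
have bq : boundary Omega q.
  apply: escaping_boundary qc => // n; have [_ h _ _] := fP n.
  by rewrite frame_dist0// ltW.
have [p bp /cvg_pinfty_rnormP gp] := ray_limit Fg gy.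
have r20 : 0 < r / 2 by rewrite divr_gt0.
have pq : p != q.
  apply/eqP => pq; have [T TP] := gp _ r20.
  have [k Tk kq] := qc _ r20 (Num.truncn T).+1.
  have Tf : T < (f k).2.
    apply: lt_trans (nf k); apply: lt_le_trans (truncnS_gt _) _.
    by rewrite ler_nat.
  have [_ _ _ rk] := fP k; have := TP _ Tf.
  have := rdist_triangle q (y k) (cmap g (f k).2).
  by rewrite (rdistC (y k) q) -pq in kq *; move: rk; rewrite -/(y k); lra.
have [r' [T [r'0 far]]] := no_far_tails bp bq pq.
have r'20 : 0 < r' / 2 by rewrite divr_gt0.
have [T' T'P] := gp _ r'20.
(* At this time [g] is near [p] and is followed closely by all late curves of the sequence. *)
pose m := (Num.truncn (Num.max T T')).+1.
have [N' _ N'P] := near_infty_natSinv_lt (PosNum r'20).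
have [n] := qc _ r'0 (maxn m N'); rewrite geq_max => /andP[mn N'n] nq.
have [nk wf _ _] := fP n.
have mT : Num.max T T' < m%:R by exact: truncnS_gt.
rewrite gt_max in mT; case/andP: mT => Tm T'm.
apply: (far (w (f n).1) (Fw _) m%:R (f n).2) => //.
  by apply: le_trans (ltW (nf n)); rewrite ler_nat.
have [_ /(_ m%:R)] := gw (f n).1; rewrite ler0n ler_nat (leq_trans mn nk).
move=> /(_ isT) h; have := T'P _ T'm.
have : (f n).1.+1%:R^-1 < r' / 2 :> R by apply: N'P; exact: leq_trans N'n nk.
move: h; set i := _^-1 => h.
have := rdist_triangle (cmap g m%:R) p (cmap (w (f n).1) m%:R); lra.
Qed.

Lemma lim_ray (g : curve R d) (p : Cn R d) : cmap g t @[t --> +oo] --> p -> cval g +oo%E = p.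
Proof. by move=> gp; apply: cvg_lim => //; exact: norm_hausdorff. Qed.

Lemma locally_close_cvg g w : F g -> clen g = +oo%E -> (forall k, F (w k)) ->
  locally_close (cmap g) w -> curve_cvg w g.
Proof.
move=> Fg gy Fw gw; split.
  rewrite gy; apply/cvgeyPge => A; exists (Num.truncn A).+1 => // k Ak.
  apply: ltW; apply: le_lt_trans (gw k).1; rewrite lee_fin ltW//.
  by apply: lt_le_trans (truncnS_gt _) _; rewrite ler_nat.
move=> theta theta0; have [r r0 rP] := enorm_small d theta0.
have [k0 k0P] := uniform_tail Fg gy Fw gw r0.
exists k0 => k kk0 [t| |]//= t0 tk.
  by rewrite gy leey; split=> //; apply: rP; apply: ltW; apply: k0P.
(* At [t = +oo] the curve [w k] must itself be a ray; the estimate at finite times passes to the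
   limit. *)
rewrite gy; split=> //; apply: rP.
have wy : clen (w k) = +oo%E by apply/eqP; rewrite eq_le leey.
have [p _ wp] := ray_limit (Fw k) wy; have [q _ gq] := ray_limit Fg gy.
rewrite -[lim _]/(cval (w k) +oo%E) -[X in _ - X]/(cval g +oo%E).
rewrite (lim_ray wp) (lim_ray gq); apply/ler_addgt0Pr => e e0.
have e20 : 0 < e / 2 by rewrite divr_gt0.
have [T1 T1P] := (cvg_pinfty_rnormP _ _).1 wp _ e20.
have [T2 T2P] := (cvg_pinfty_rnormP _ _).1 gq _ e20.
pose t := Num.max 0 (Num.max T1 T2) + 1.
have t0' : 0 <= t by rewrite /t addr_ge0// le_max lexx.
have T1t : T1 < t by rewrite /t ltr_pwDr// !le_max lexx orbT.
have T2t : T2 < t by rewrite /t ltr_pwDr// !le_max lexx !orbT.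
have := k0P k kk0 t (ray_dom wy t0'); have := T1P _ T1t; have := T2P _ T2t.
have := rdist_triangle (cmap (w k) t) p q.
have := rdist_triangle (cmap g t) (cmap (w k) t) q.
rewrite (rdistC (cmap g t) q); lra.
Qed.

(** The default value [x0] keeps the curve within [|t|] of [x0] for every real [t], as [limit_curve]
    requires. *)
Definition extend_by_x0 (g : curve R d) (t : R) : Cn R d :=
  if (0 <= t) && (t%:E <= clen g)%E then cmap g t else x0.

Lemma extendE (g : curve R d) t : cdom g t -> extend_by_x0 g t = cmap g t.
Proof. by move=> [t0 tg]; rewrite /extend_by_x0 t0 tg. Qed.

Lemma extend_kball g t : F g -> kball Omega x0 `|t| (extend_by_x0 g t).
Proof.
move=> Fg; rewrite /extend_by_x0; case: ifPn => [/andP[t0 tg]|_].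
  have gt : cdom g t by [].
  by split; [exact: frame_Omega|rewrite frame_dist0// ger0_norm].
by split=> //; rewrite (kobayashi_refl mK).
Qed.

Lemma lipschitz_of_geodesic (m : R) (g : R -> Cn R d) :
  (forall t, 0 <= t <= m -> kball Omega x0 `|t| (g t)) ->
  (forall s t, 0 <= s <= m -> 0 <= t <= m -> K (g s) (g t) = `|s - t|) ->
  lipschitz_curve Omega x0 m g.
Proof.
move=> gb gK t tm; split; last by move=> s sm; rewrite gK.
have [Og Kg] := gb t tm; split=> //; apply: le_trans Kg _.
by case/andP: tm => t0 tm; rewrite ger0_norm.
Qed.

Lemma extend_lipschitz g (m : R) : F g -> (m%:E <= clen g)%E ->
  lipschitz_curve Omega x0 m (extend_by_x0 g).
Proof.
move=> Fg mg; have dom t : 0 <= t <= m -> cdom g t.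
  by move=> /andP[t0 tm]; split=> //; apply: le_trans mg; rewrite lee_fin.
apply: lipschitz_of_geodesic => [t _|s t /dom gs /dom gt]; first exact: extend_kball.
by rewrite !extendE// frame_dist.
Qed.

Lemma kball0 y : kball Omega x0 `|0 : R| y -> y = x0.
Proof.
move=> [Oy Ky]; apply/esym/(kobayashi_eq0 mK Ox0 Oy)/eqP.
by rewrite normr0 in Ky; rewrite eq_le Ky (kobayashi_ge0 mK).
Qed.

Lemma frame_cvg_same_length u (n : nat) : (forall k, F (u k)) ->
  (forall k, clen (u k) = (n.+1%:R * c)%:E) ->
  exists phi : nat -> nat, {homo phi : m n / (m < n)%N} /\
  exists2 g, F g & curve_cvg (u \o phi) g.
Proof.
set T := n.+1%:R * c => Fu uT.
have T0 : 0 <= T by rewrite mulr_ge0// ltW.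
have dom k t : 0 <= t <= T -> cdom (u k) t.
  by move=> /andP[t0 tT]; split=> //; rewrite uT lee_fin.
have [||g [gball gK hg]] := @limit_curve R d Omega mK openO compactK M x0
    [set t | 0 <= t <= T] (fun k => extend_by_x0 (u k)) boundO Ox0.
- by move=> k t; exact: extend_kball.
- move=> s t sT tT e e0; exists 0%N => k _.
  rewrite !extendE ?frame_dist//; try exact: dom.
  by rewrite subrr normr0 ltW.
pose G := Curve T%:E g.
have Gdom t : cdom G t -> 0 <= t <= T by rewrite /cdom/= lee_fin => -[-> ->].
have FG : F G.
  split=> /=; [exact: kball0 (gball 0)| |by right; exists n].
  apply: isometry_geodesic => // [t _|s t /Gdom ? /Gdom ?]; first exact: (gball t).1.
  exact: gK.
have unif := @family_cvg_unif R d Omega mK openO compactK x0 T _ g 0%N Ox0 T0 _ _ hg.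
have [j N|phi [phiS phiP]] := @extract_subseq (fun j k => forall t, 0 <= t <= T ->
    rnorm (g t - extend_by_x0 (u k) t) < j.+1%:R^-1).
  apply: unif; last by rewrite invr_gt0.
    by apply: lipschitz_of_geodesic => [t _|s t]; [exact: gball|exact: gK].
  by move=> k _; apply: extend_lipschitz => //; rewrite uT.
exists phi; split=> //; exists G => //; split.
  rewrite (_ : (fun k => _) = cst T%:E); first exact: cvg_cst.
  by apply/funext => k; rewrite /= uT.
move=> theta theta0; have [r r0 rP] := enorm_small d theta0.
have [N _ NP] := near_infty_natSinv_lt (PosNum r0).
exists N => k Nk [t| |]//=; rewrite uT ?lee_fin => t0 tT; split=> //.
have tT' : 0 <= t <= T by rewrite t0.
apply: rP; rewrite rdistC ltW//; have := phiP k t tT'.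
by rewrite extendE; [move=> /lt_trans; apply; exact: NP|exact: dom].
Qed.

(** Arzela-Ascoli on each [[0, j]], followed by a diagonal extraction; [locally_close_cvg] then
    makes the convergence uniform up to the ends. *)
Lemma frame_cvg_ray u : (forall k, F (u k)) ->
  (forall T : R, exists N, forall k, (N <= k)%N -> (T%:E < clen (u k))%E) ->
  exists phi : nat -> nat, {homo phi : m n / (m < n)%N} /\
  exists2 g, F g & curve_cvg (u \o phi) g.
Proof.
move=> Fu uy.
have [||g [gball gK hg]] := @limit_curve R d Omega mK openO compactK M x0
    [set t | 0 <= t] (fun k => extend_by_x0 (u k)) boundO Ox0.
- by move=> k t; exact: extend_kball.
- move=> s t /= s0 t0 e e0; have [N NP] := uy (Num.max s t).
  exists N => k /NP /ltW uk.
  have us : cdom (u k) s.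
    by split=> //; apply: le_trans uk; rewrite lee_fin le_max lexx.
  have ut : cdom (u k) t.
    by split=> //; apply: le_trans uk; rewrite lee_fin le_max lexx orbT.
  by rewrite !extendE// frame_dist// subrr normr0 ltW.
pose G := Curve +oo%E g.
have FG : F G.
  split=> /=; [exact: kball0 (gball 0)| |by left].
  apply: isometry_geodesic => // [t _|s t [? _] [? _]]; first exact: (gball t).1.
  exact: gK.
have [j N|phi [phiS phiP]] := @extract_subseq (fun j k =>
    (j%:R%:E < clen (u k))%E /\
    forall t, 0 <= t <= j%:R -> rnorm (g t - cmap (u k) t) < j.+1%:R^-1).
  have [N0 N0P] := uy j%:R.
  have [|||k] := @family_cvg_unif R d Omega mK openO compactK x0 j%:R
      (fun k => extend_by_x0 (u k)) g N0 Ox0 (ler0n _ _) _ _ hg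
      (j.+1%:R^-1) _ (maxn N0 N).
  - apply: lipschitz_of_geodesic => [t _|s t /andP[s0 _] /andP[t0 _]].
      exact: gball.
    exact: gK.
  - by move=> k Nk; apply: extend_lipschitz => //; apply: ltW; exact: N0P.
  - by rewrite invr_gt0.
  rewrite geq_max => /andP[N0k Nk] kP; exists k => //; split; first exact: N0P.
  move=> t tj; have := kP t tj; rewrite extendE//.
  case/andP: tj => t0 tj; split=> //; apply: ltW; apply: le_lt_trans (N0P k N0k).
  by rewrite lee_fin.
exists phi; split=> //; exists G => //.
by apply: locally_close_cvg => // k; exact: Fu.
Qed.

(** Either some finite length occurs infinitely often, or each occurs finitely often and the lengths
    tend to [+oo]. *)
Lemma frame_sequentially_compact u : (forall k, F (u k)) ->
  exists phi : nat -> nat, {homo phi : m n / (m < n)%N} /\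
  exists2 g, F g & curve_cvg (u \o phi) g.
Proof.
move=> Fu.
have [[n nP]|noconst] := pselect (exists n, forall N, exists2 k, (N <= k)%N &
    clen (u k) = (n.+1%:R * c)%:E).
  have [|psi [psiS psiP]] := @extract_subseq (fun _ k => clen (u k) = (n.+1%:R * c)%:E).
    by move=> _; exact: nP.
  have [phi [phiS [g Fg ug]]] :=
    frame_cvg_same_length (fun k => Fu (psi k)) psiP.
  exists (psi \o phi); split; last by exists g.
  by move=> a b ab; exact/psiS/phiS.
apply: frame_cvg_ray => //.
(* The multiples of [c] are excluded one after another by induction on [n]. *)
have long n : exists N, forall k, (N <= k)%N -> ((n%:R * c)%:E < clen (u k))%E.
  elim: n => [|n [N NP]].
    by exists 0%N => k _; rewrite mul0r; exact: frame_len_gt0.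
  have [N' N'P] : exists N', forall k, (N' <= k)%N -> clen (u k) <> (n.+1%:R * c)%:E.
    apply: contrapT => h; apply: noconst; exists n => N'; apply: contrapT => h'.
    by apply: h; exists N' => k Nk uk; apply: h'; exists k.
  exists (maxn N N') => k; rewrite geq_max => /andP[/NP uk /N'P uk'].
  have [_ _ [->|[m um]]] := Fu k; first by rewrite ltry.
  move: uk uk'; rewrite um !lte_fin !ltr_pM2r// !ltr_nat => nm mn.
  rewrite ltn_neqAle nm andbT; apply/eqP => e; apply: mn; congr ((_%:R * c)%:E).
  by rewrite -e.
move=> T; have [N NP] := long (Num.truncn (T / c)).+1; exists N => k /NP.
apply: lt_trans; rewrite lte_fin -ltr_pdivrMr//; exact: truncnS_gt.
Qed.

End Frame.

(** * Choice of the base point and of the length unit, and conclusion *)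

Lemma bounded_rnorm (R : realType) (d : nat) (A : set (Cn R d)) :
  bounded_set A -> exists M : R, forall z, A z -> rnorm z <= M.
Proof.
move=> [m [mreal mP]]; exists (complex.Re m + 1) => z Az.
rewrite -lecR -rnormE; apply: (mP _ _ z Az).
by rewrite -[ltLHS]RRe_real// ltcR ltrDl ltr01.
Qed.

(** Supplies the second point whose distance from [x0] is the unit [c > 0]. *)
Lemma open_other_point (R : realType) (d : nat) (A : set (Cn R d)) x :
  (0 < d)%N -> open A -> A x -> exists2 y, A y & y != x.
Proof.
move=> d0 oA Ax; have /nbhs_rnormP[r r0 rA] : nbhs x A by exact: open_nbhs_nbhs.
pose v : Cn R d := const_mx 1.
have v0 : v != 0.
  apply/eqP => /matrixP /(_ 0 (Ordinal d0)); rewrite !mxE => /eqP.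
  by rewrite oner_eq0.
have nv : 0 < rnorm v.
  rewrite lt_neqAle rnorm_ge0 andbT eq_sym.
  by apply/eqP => /rnorm_eq0; exact/eqP.
have t0 : 0 < r / 2 / rnorm v by rewrite !divr_gt0.
exists (x + (r / 2 / rnorm v)%:C%C *: v).
  apply: rA; rewrite rdistC addrC addKr rnormZ normcRE gtr0_norm// divfK ?gt_eqF//.
  lra.
rewrite addrC -subr_eq0 addrK scaler_eq0 negb_or v0 andbT.
by apply/eqP => /complexI h; move: t0; rewrite h ltxx.
Qed.

Theorem proposition3p2 (R : realType) (d : nat) (d_gt0 : (0 < d)%N)
    (Omega : set (Cn R d)) (domOmega : is_domain Omega)
    (bndOmega : bounded_set Omega)
    (complOmega : complete_metric_on Omega (kobayashi Omega)) :
  visible Omega -> exists F : set (curve R d), frame_of_geodesics Omega F.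
Proof.
move=> visO; have [[x0 Ox0] openO _] := domOmega; have [mK cK] := complOmega.
have [M boundO] := bounded_rnorm bndOmega.
have [x1 Ox1 x10] := open_other_point d_gt0 openO Ox0.
have compactK x (r : R) : Omega x -> seq_compact (kball Omega x r).
  exact: kball_compact.
pose c := kobayashi Omega x0 x1.
have c0 : 0 < c.
  rewrite lt_neqAle kobayashi_ge0// andbT; apply/eqP => /esym h.
  by move: x10; rewrite (kobayashi_eq0 mK Ox0 Ox1 h) eqxx.
exists (quantized_geodesics Omega x0 c); split.
- by move=> g Fg; split; [exact: frame_len_gt0 Fg|case: Fg].
- by move=> g Fg; exact: (ray_limit mK openO visO boundO Ox0 c0 Fg).
- exists [set x0]; split; first exact: compact_set1.
    by move=> _ ->.
  by move=> g [].
- move=> u Fu; exact: (frame_sequentially_compact mK openO compactK visO boundO Ox0 c0 Fu).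
(* The value [1] is arbitrary: every point of [Omega] is at distance less than [c] from the
   frame. *)
- exists 1, c; split=> // z Oz _.
  exact: (frame_dense mK openO compactK boundO Ox0 c0 Ox1 erefl Oz).
Qed.
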